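(* Let $\mathbb{k}$ be a field. Any graph $G$ has an induced subgraph $H$ such that $$\operatorname{proj-dim}(G)=\operatorname{reg}(S(H)).$$
   Context: Graphs are finite, without loops or multiple edges. The subdivision graph $S(H)$ of a graph $H$ is obtained from $H$ by subdividing each edge exactly once; equivalently it is the bipartite graph on $V(H)\cup E(H)$ with $x\in V(H)$ adjacent to $e\in E(H)$ if and only if $x\in e$. Fix a field $\mathbb{k}$. For a graph $G$ with vertex set $V$, let $R=\mathbb{k}[V]$ and let $I_G=(xy: xy\in E(G))$ be its edge ideal. Then $\operatorname{proj-dim}(G):=\operatorname{proj-dim}(R/I_G)=\max\{i:\beta_{i,j}(R/I_G)\neq0\text{ for some }j\}$ and $\operatorname{reg}(G):=\operatorname{reg}(R/I_G)=\max\{j-i:\beta_{i,j}(R/I_G)\neq0\}$. *)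

(* Defs.v *)
From HB Require Import structures.
From mathcomp Require Import all_boot all_order all_algebra.
From mathcomp Require Import mpoly.

Set Implicit Arguments.
Unset Strict Implicit.
Unset Printing Implicit Defensive.

Import GRing.Theory.
Local Open Scope ring_scope.

Record sgraph := SGraph {
  vertex :> finType;
  adj : rel vertex;
  adj_sym : ssrbool.symmetric adj;
  adj_irr : irreflexive adj
}.

Section InducedSubgraph.
Variables (G : sgraph) (W : {set G}).

Definition induced_adj : rel {x : G | x \in W} :=
  fun u v => adj (val u) (val v).

Lemma induced_adj_sym : ssrbool.symmetric induced_adj.
Proof. by move=> u v; apply: adj_sym. Qed.

Lemma induced_adj_irr : irreflexive induced_adj.
Proof. by move=> u; apply: adj_irr. Qed.

Definition induced : sgraph := SGraph induced_adj_sym induced_adj_irr.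
End InducedSubgraph.

Section Subdivision.
Variable H : sgraph.

Definition edges : {set {set H}} :=
  [set A : {set H} | [exists x, exists y, adj x y && (A == [set x; y])]].

Definition subdiv_adj : rel (H + {A : {set H} | A \in edges})%type :=
  fun u v => match u, v with
             | inl x, inr a => x \in val a
             | inr a, inl x => x \in val a
             | _, _ => false
             end.

Lemma subdiv_adj_sym : ssrbool.symmetric subdiv_adj.
Proof. by case=> [x|a] [y|b]. Qed.

Lemma subdiv_adj_irr : irreflexive subdiv_adj.
Proof. by case. Qed.

Definition subdivision : sgraph := SGraph subdiv_adj_sym subdiv_adj_irr.
End Subdivision.

(* The ring k[V] is {mpoly k[#|V|]}, its variables being numbered by [enum_rank]. *)
Definition edge_ideal (k : fieldType) (G : sgraph) (p : {mpoly k[#|G|]}) : Prop :=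
  exists c : G -> G -> {mpoly k[#|G|]},
    p = \sum_x \sum_(y | adj x y) c x y * ('X_(enum_rank x) * 'X_(enum_rank y)).

Section GradedBetti.
Variables (k : fieldType) (n : nat).
Local Notation R := {mpoly k[n]}.

(* A sequence ... -> F_2 -> F_1 -> F_0 -> R of finitely generated graded free
   modules, where F_i has a basis indexed by a < grank i, of degrees gdeg a.
   Elements of F_i are row vectors; maps act by multiplication on the right. *)
Record graded_seq := GradedSeq {
  grank : nat -> nat;
  gdeg : forall i, 'I_(grank i) -> nat;
  gdiff : forall i, 'M[R]_(grank i.+1, grank i);
  gaug : 'cV[R]_(grank 0)
}.

Variable F : graded_seq.

(* The maps are homogeneous of degree 0; in particular an entry whose expected
   degree would be negative vanishes. *)
Definition homogeneous_maps : Prop :=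
  (forall a m, m \in msupp (gaug F a 0) -> mdeg m = gdeg a) /\
  (forall i a b m, m \in msupp (gdiff F i a b) ->
     (mdeg m + gdeg b)%N = gdeg a).

(* [gaug] lifts to R the augmentation F_0 -> R/I, so surjectivity and exactness
   at F_0 are read modulo I. *)
Definition graded_free_resolution (I : R -> Prop) : Prop :=
  [/\ homogeneous_maps,
      forall p : R, exists v : 'rV_(grank F 0), I (p - (v *m gaug F) 0 0),
      forall v : 'rV_(grank F 0),
        I ((v *m gaug F) 0 0) <-> exists w, v = w *m gdiff F 0
    & forall i (v : 'rV_(grank F i.+1)),
        v *m gdiff F i = 0 <-> exists w, v = w *m gdiff F i.+1].

(* The differential of F (x) k, where k = R/(x_1, ..., x_n). *)
Definition fiber_diff i : 'M[k]_(grank F i.+1, grank F i) :=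
  map_mx (mcoeff 0%MM) (gdiff F i).

(* The row space is the degree j component of F_i (x) k. *)
Definition fiber_comp i j : 'M[k]_(grank F i) :=
  diag_mx (\row_a (gdeg a == j)%:R).

Definition fiber_cycles i j : 'M[k]_(grank F i) :=
  match i with
  | 0 => fiber_comp 0 j
  | i'.+1 => (fiber_comp i'.+1 j :&: kermx (fiber_diff i'))%MS
  end.

Definition fiber_boundaries i j : 'M[k]_(grank F i.+1, grank F i) :=
  fiber_comp i.+1 j *m fiber_diff i.

(* dim_k H_i(F (x) k)_j; boundaries are cycles when F is a complex. *)
Definition fiber_homology_dim i j : nat :=
  \rank (fiber_cycles i j) - \rank (fiber_boundaries i j).
End GradedBetti.

(* beta_{i,j}(R/I) = dim_k Tor_i^R(R/I, k)_j *)
Definition graded_betti (k : fieldType) (n : nat) (I : {mpoly k[n]} -> Prop)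
    (beta : nat -> nat -> nat) : Prop :=
  exists2 F : graded_seq k n, graded_free_resolution F I
    & forall i j, beta i j = fiber_homology_dim F i j.

Definition is_proj_dim (k : fieldType) (G : sgraph) (p : nat) : Prop :=
  exists2 beta, graded_betti (@edge_ideal k G) beta
    & (exists j, beta p j <> 0%N) /\
      (forall i j, beta i j <> 0%N -> (i <= p)%N).

(* The maximum of the integers j - i; it is nonnegative as beta_{0,0} = 1. *)
Definition is_reg (k : fieldType) (G : sgraph) (r : nat) : Prop :=
  exists2 beta, graded_betti (@edge_ideal k G) beta
    & (exists i, beta i (i + r)%N <> 0%N) /\
      (forall i j, beta i j <> 0%N -> (j <= i + r)%N).

(* Main.v *)
(* Tensoring the Taylor resolution of R/I_G with k splits by squarefree
   multidegree: the part of multidegree W is spanned by the sets c of edges with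
   union W. The independent sets of S(G[W]) are the pairs (c, tau) of a set of
   edges inside W and a set of vertices of W not covered by c, so this complex
   filters in two ways. Contracting tau shows that H_i of the Taylor part at W is
   the homology of Ind(S(G[W])) in cardinality i; contracting c shows that it is
   also the homology of the complex of vertex covers of G[W], which is dual to
   Ind(G[W]) (Hochster). Writing N(B, s) for "Ind(B[U]) has homology in
   cardinality s for some vertex set U", we get that reg(B) is the largest s with
   N(B, s), and that p = proj-dim(G) is attained as N(S(G[W]), p) for some W.
   Finally, take W minimal such that N(S(G[W]), s) for some s >= p. If s > p could
   occur, choose U minimal for it; U contains a vertex x of W, and deleting x from U
   kills the homology, so the link of x gives N(S(G[W \ x]), s - 1), against the
   minimality of W. Hence reg(S(G[W])) = p. *)
Require Import Defs.
From mathcomp Require Import all_boot all_algebra.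
From mathcomp Require Import mpoly ring.
From Stdlib Require Import Classical_Prop.

Set Implicit Arguments.
Unset Strict Implicit.
Unset Printing Implicit Defensive.

Import GRing.Theory.
Local Open Scope ring_scope.

(** * Based complexes and their homology *)

Section BasedComplex.
Variables (k : fieldType) (T : finType).
Implicit Types (d : T -> T -> k) (P Q : {set T}) (v w phi : T -> k).

(** [d a b] is the coefficient of [b] in the differential of [a]. Chains are functions on all of
    [T], of which only the values on [P] matter; a complex is thus a fixed matrix cut down to
    varying [P]. *)
Definition bd d P v b : k := \sum_(a in P) v a * d a b.

Definition is_complex d P :=
  forall a c, a \in P -> c \in P -> \sum_(b in P) d a b * d b c = 0.

Definition cycle_on d P v := forall b, b \in P -> bd d P v b = 0.

Definition acyclic d P :=
  forall v, cycle_on d P v -> exists w, forall b, b \in P -> v b = bd d P w b.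

Definition concentrated (deg : T -> nat) P i v :=
  forall a, a \in P -> v a != 0 -> deg a = i.

(* Non-vanishing of homology in degree [i], witnessed by a cycle and a cocycle
   with non-zero pairing; this form is visibly invariant under transposition. *)
Definition nonzero_homology d (deg : T -> nat) P i :=
  exists v phi,
    [/\ concentrated deg P i v, concentrated deg P i phi, cycle_on d P v,
        cycle_on (fun a b => d b a) P phi & \sum_(a in P) v a * phi a != 0].

Lemma nonzero_homology_cell d deg P i :
  nonzero_homology d deg P i -> exists2 a, a \in P & deg a = i.
Proof.
move=> [v [phi [hv _ _ _ nz]]].
suff [a Pa va] : exists2 a, a \in P & v a != 0 by exists a; last exact: hv.
apply/exists_inP; apply: contraR nz; rewrite negb_exists_in => /forall_inP z.
by rewrite big1 // => a /z; rewrite negbK => /eqP->; rewrite mul0r.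
Qed.

Lemma bdD d P v w b : bd d P (fun a => v a + w a) b = bd d P v b + bd d P w b.
Proof. by rewrite -big_split; apply: eq_bigr => a _; rewrite mulrDl. Qed.

Lemma bdB d P v w b : bd d P (fun a => v a - w a) b = bd d P v b - bd d P w b.
Proof. by rewrite -sumrB; apply: eq_bigr => a _; rewrite mulrBl. Qed.

Lemma eq_bd d P v w : {in P, v =1 w} -> bd d P v =1 bd d P w.
Proof. by move=> e b; apply: eq_bigr => a Pa; rewrite e. Qed.

Lemma bd_bd d P v : is_complex d P -> cycle_on d P (bd d P v).
Proof.
move=> cx c Pc; rewrite /bd; under eq_bigr do rewrite mulr_suml.
rewrite exchange_big big1 // => a Pa.
by under eq_bigr do rewrite -mulrA; rewrite -mulr_sumr cx ?mulr0.
Qed.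

Lemma bd_sub d P Q v b : Q \subset P ->
  {in P :\: Q, forall a, v a * d a b = 0} -> bd d P v b = bd d Q v b.
Proof.
move=> QP v0; rewrite /bd (big_setID Q) /= (setIidPr QP) [X in _ + X]big1 ?addr0 //.
Qed.

Definition cut Q v a := if a \in Q then v a else 0.

Lemma bd_cut d P Q v b : Q \subset P -> bd d P (cut Q v) b = bd d Q v b.
Proof.
move=> QP; rewrite (bd_sub QP); first by apply: eq_bd => a; rewrite /cut => ->.
by move=> a; rewrite !inE /cut => /andP[/negPf-> _]; rewrite mul0r.
Qed.

Definition graded_by d (deg : T -> nat) := forall a b, d a b != 0 -> deg a = (deg b).+1.

(** Only the degree [i] part of [w] reaches degree [i - 1], and [v] vanishes in the other degrees,
    so a bounding chain may be taken homogeneous. *)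
Lemma bd_homog d deg P i v w : graded_by d deg ->
  {in P, forall b, v b = bd d P w b} ->
  (forall b, b \in P -> v b != 0 -> (deg b).+1 = i) ->
  {in P, forall b, v b = bd d P (fun a => if deg a == i then w a else 0) b}.
Proof.
move=> gr e hv b Pb; have [vb0|vb0] := eqVneq (v b) 0; last first.
  rewrite e //; apply: eq_bigr => a Pa; case: eqP => // /eqP ne.
  have [->|/gr dd] := eqVneq (d a b) 0; first by rewrite !mulr0.
  by rewrite dd hv ?eqxx in ne.
have [bi|bi] := eqVneq (deg b).+1 i.
  rewrite e //; apply: eq_bigr => a Pa; case: eqP => // /eqP ne.
  have [->|/gr dd] := eqVneq (d a b) 0; first by rewrite !mulr0.
  by rewrite dd bi eqxx in ne.
rewrite vb0 /bd big1 // => a Pa; case: eqP => [ai|_]; last by rewrite mul0r.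
have [->|/gr dd] := eqVneq (d a b) 0; first by rewrite mulr0.
by rewrite -dd ai eqxx in bi.
Qed.

(** A boundary pairs to zero with every cocycle. Conversely, over a field, a vector outside the row
    space of the differential is separated from it by a linear functional, which is a cocycle. *)
Lemma nonzero_homologyP d deg P i : graded_by d deg ->
  nonzero_homology d deg P i <->
  exists v, [/\ concentrated deg P i v, cycle_on d P v
              & ~ exists w, {in P, forall b, v b = bd d P w b}].
Proof.
move=> gr; split=> [[v [phi [hv hphi cv cphi nz]]]|[v [hv cv nb]]].
  exists v; split=> // -[w e]; case/eqP: nz.
  under eq_bigr => a Pa do rewrite e // mulr_suml.
  rewrite exchange_big big1 // => b Pb.
  under eq_bigr => a Pa do rewrite -mulrA [d _ _ * _]mulrC.
  by rewrite -mulr_sumr [X in _ * X]cphi ?mulr0.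
pose D : 'M[k]_#|T| := \matrix_(x, y)
  if (enum_val x \in P) && (enum_val y \in P) then d (enum_val x) (enum_val y) else 0.
pose V : 'rV[k]_#|T| := \row_x cut P v (enum_val x).
have sumE (F : T -> k) : \sum_(x < #|T|) F (enum_val x) = \sum_a F a.
  by rewrite (reindex _ (onW_bij _ (enum_val_bij T))).
have VD : ~~ (V <= D)%MS.
  apply/negP => /submxP[w Ew]; apply: nb; exists (fun a => w 0 (enum_rank a)).
  move=> b Pb; move/rowP: Ew => /(_ (enum_rank b)).
  rewrite !mxE enum_rankK /cut Pb => ->.
  rewrite /bd [RHS]big_mkcond -sumE; apply: eq_bigr => x _.
  by rewrite !mxE enum_rankK Pb andbT enum_valK; case: ifP; rewrite ?mulr0.
(* Some column of the cokernel matrix kills the row space but not [V]; it is the separating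
   functional. *)
have {VD} [K DK /rV0Pn[j nzj]] : exists2 K : 'M_#|T|, D *m K = 0 & V *m K != 0.
  by exists (cokermx D); [exact: mulmx_coker | rewrite -submxE].
pose phi a := K (enum_rank a) j.
have cophi : cycle_on (fun a b => d b a) P phi.
  move=> a Pa; have /matrixP/(_ (enum_rank a) j) := DK.
  rewrite !mxE => z; rewrite -[RHS]z /bd [LHS]big_mkcond -sumE; apply: eq_bigr => x _.
  by rewrite !mxE enum_rankK Pa /= /phi enum_valK; case: ifP; rewrite ?mul0r // mulrC.
(* Truncating [phi] to degree [i] keeps it a cocycle, by the grading, and does not change its
   pairing with [v]. *)
exists v, (fun a => if deg a == i then phi a else 0); split=> //.
- by move=> a Pa; case: (deg a =P i) => // _; rewrite eqxx.
- move=> a Pa; have [ai|ai] := eqVneq (deg a) i.+1; last first.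
    rewrite /bd big1 // => b Pb; case: eqP => [bi|_]; last by rewrite mul0r.
    have [->|/gr dd] := eqVneq (d a b) 0; first by rewrite mulr0.
    by rewrite dd bi eqxx in ai.
  rewrite -[RHS](cophi a Pa); apply: eq_bigr => b Pb; case: eqP => // /eqP bi.
  have [->|/gr dd] := eqVneq (d a b) 0; first by rewrite !mulr0.
  by move: ai bi; rewrite dd => -[->]; rewrite eqxx.
apply: contra nzj => /eqP z; rewrite mxE -[X in _ == X]z [X in _ == X]big_mkcond.
rewrite -sumE; apply/eqP; apply: eq_bigr => x _; rewrite !mxE /cut /phi enum_valK.
case: ifP => [Px|_]; last by rewrite mul0r.
case: eqP => // ne.
by have [->|/hv] := eqVneq (v (enum_val x)) 0; rewrite ?mul0r // => /(_ Px).
Qed.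

(** * Subcomplexes, quotients and the exact sequence of homology *)

Section Split.
Variables (d : T -> T -> k) (P Q : {set T}).
Hypotheses (QP : Q \subset P) (cx : is_complex d P).
Hypothesis Qsub : {in Q & P :\: Q, forall a b, d a b = 0}.

Let RP : P :\: Q \subset P. Proof. exact: subsetDl. Qed.

Lemma bd_quotient v b : b \in P :\: Q -> bd d P v b = bd d (P :\: Q) v b.
Proof.
move=> Rb; apply: bd_sub => // a; rewrite setDDr setDv set0U => /setIP[_ Qa].
by rewrite Qsub ?mulr0.
Qed.

Lemma is_complex_sub : is_complex d Q.
Proof.
move=> a c Qa Qc; have [Pa Pc] := (subsetP QP a Qa, subsetP QP c Qc).
have := cx Pa Pc; rewrite (big_setID Q) /= (setIidPr QP) [X in _ + X]big1 ?addr0 //.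
by move=> b Rb; rewrite Qsub ?mul0r.
Qed.

(** Subtracting the boundary of a lift of [w2] moves the cycle [v] into the subcomplex [Q] without
    changing its class. *)
Lemma split_boundary v w2 :
  cycle_on d P v -> {in P :\: Q, forall b, v b = bd d (P :\: Q) w2 b} ->
  let u a := v a - bd d P (cut (P :\: Q) w2) a in
  [/\ cycle_on d P u, {in P :\: Q, forall b, u b = 0} & cycle_on d Q u].
Proof.
move=> cv e2 u.
have u0 : {in P :\: Q, forall b, u b = 0}.
  by move=> b Rb; rewrite /u e2 // bd_cut // subrr.
have cu : cycle_on d P u.
  by move=> b Pb; rewrite /u bdB cv // bd_bd // subrr.
split=> // b Qb; have Pb := subsetP QP b Qb.
rewrite -[RHS](cu b Pb); symmetry; apply: bd_sub => // a Ra.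
by rewrite u0 ?mul0r.
Qed.

Lemma split_glue v w2 w1 :
  cycle_on d P v -> {in P :\: Q, forall b, v b = bd d (P :\: Q) w2 b} ->
  {in Q, forall b, v b - bd d P (cut (P :\: Q) w2) b = bd d Q w1 b} ->
  exists w, {in P, forall b, v b = bd d P w b}.
Proof.
move=> cv e2 e1; have [_ u0 _] := split_boundary cv e2.
exists (fun a => cut (P :\: Q) w2 a + cut Q w1 a) => b Pb.
rewrite bdD [X in _ + X]bd_cut //; have [Qb|nQb] := boolP (b \in Q).
  by rewrite -e1 // addrC subrK.
have Rb : b \in P :\: Q by rewrite inE nQb.
rewrite [X in _ + X]big1 ?addr0; last by move=> a Qa; rewrite Qsub ?mulr0.
by move/eqP: (u0 b Rb); rewrite subr_eq0 => /eqP.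
Qed.

Lemma acyclic_split : acyclic d Q -> acyclic d (P :\: Q) -> acyclic d P.
Proof.
move=> aQ aR v cv; have [|w2 e2] := aR v.
  by move=> b Rb; rewrite -bd_quotient // cv // (subsetP RP).
have [_ _ cu] := split_boundary cv e2; have [w1 e1] := aQ _ cu.
exact: split_glue cv e2 e1.
Qed.

Variable deg : T -> nat.
Hypothesis gr : graded_by d deg.

(** Exactness of H_i(Q) -> H_i(P) -> H_i(P/Q) in the middle: a class that dies in the quotient comes
    from [Q]. *)
Lemma nonzero_homology_split i : nonzero_homology d deg P i ->
  nonzero_homology d deg Q i \/ nonzero_homology d deg (P :\: Q) i.
Proof.
move=> /(nonzero_homologyP _ _ gr)[v [hv cv nb]].
have cR : cycle_on d (P :\: Q) v.
  by move=> b Rb; rewrite -bd_quotient // cv // (subsetP RP).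
have [[w2 e2]|nR] := classic (exists w, {in P :\: Q, forall b, v b = bd d (P :\: Q) w b});
  last first.
  right; apply/(nonzero_homologyP _ _ gr); exists v; split=> // a Ra.
  by apply: hv; apply: subsetP Ra.
(* The bounding chain is made homogeneous so that the corrected cycle on [Q] stays in degree [i]. *)
have {}e2 := bd_homog (i := i.+1) gr e2 (fun b Rb vb => congr1 S (hv b (subsetP RP b Rb) vb)).
set w2' := (fun a => if deg a == i.+1 then w2 a else 0) in e2.
have [_ u0 cu] := split_boundary cv e2.
left; apply/(nonzero_homologyP _ _ gr); eexists; split; [|exact: cu|].
- move=> a Qa; have Pa := subsetP QP a Qa; apply: contraNeq => ai.
  have -> : v a = 0 by apply: contraNeq ai => /hv ->.
  rewrite sub0r oppr_eq0 /bd big1 // => b Pb; rewrite /cut /w2'.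
  case: ifP => _; last by rewrite mul0r.
  case: eqP => bi; last by rewrite mul0r.
  have [->|/gr dd] := eqVneq (d b a) 0; first by rewrite mulr0.
  by move: dd ai; rewrite bi => -[->]; rewrite eqxx.
- by move=> [w1 e1]; apply: nb; apply: split_glue cv e2 e1.
Qed.

(** For the converse, a cycle of the quotient is lifted by zero. Its boundary is a cycle of [Q],
    hence bounds some [w] there, and subtracting [w] turns the lift into a cycle of [P]. *)
Lemma nonzero_homology_quotient i : acyclic d Q ->
  nonzero_homology d deg P i <-> nonzero_homology d deg (P :\: Q) i.
Proof.
move=> aQ; split=> [/nonzero_homology_split[|//]|].
  by move=> /(nonzero_homologyP _ _ gr)[v [_ cv []]]; apply: aQ.
move=> /(nonzero_homologyP _ _ gr)[v [hv cv nb]].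
pose v' := cut (P :\: Q) v.
have v'E b : b \in P -> bd d P v' b = if b \in Q then bd d P v' b else 0.
  move=> Pb; case: ifP => // nQb; rewrite bd_cut // cv //.
  by rewrite inE nQb.
have hv' a : a \in P -> v' a != 0 -> deg a = i.
  by move=> _; rewrite /v' /cut; case: ifP => [Ra|_]; [apply: hv | rewrite eqxx].
have cbd : cycle_on d Q (bd d P v').
  move=> b Qb; have Pb := subsetP QP b Qb.
  rewrite -[RHS](bd_bd v' cx Pb); symmetry; apply: bd_sub => // a.
  by rewrite inE => /andP[nQa Pa]; rewrite v'E // (negPf nQa) mul0r.
have [w e] := aQ _ cbd.
pose w' a := if deg a == i then w a else 0.
have {}e : {in Q, forall b, bd d P v' b = bd d Q w' b}.
  apply: bd_homog gr e _ => b Qb; apply: contraNeq => bi; rewrite /bd big1 // => a Pa.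
  have [->|/hv' hva] := eqVneq (v' a) 0; first by rewrite mul0r.
  have [->|/gr dd] := eqVneq (d a b) 0; first by rewrite mulr0.
  by rewrite -dd hva ?eqxx in bi.
apply/(nonzero_homologyP _ _ gr); exists (fun a => v' a - cut Q w' a); split.
- move=> a Pa; rewrite /v' /cut inE Pa andbT; case Qa: (a \in Q) => /=.
    by rewrite sub0r oppr_eq0 /w'; case: (deg a =P i) => // _; rewrite eqxx.
  by rewrite subr0; apply: hv; rewrite inE Qa.
- move=> b Pb; rewrite bdB [X in _ - X]bd_cut // v'E //; case: ifP => Qb.
    by rewrite e // subrr.
  rewrite sub0r /bd big1 ?oppr0 // => a Qa; rewrite Qsub ?mulr0 //.
  by rewrite inE Qb.
- move=> [u eu]; apply: nb; exists u => b Rb.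
  rewrite -bd_quotient // -eu ?(subsetP RP) // /v' /cut Rb.
  by move: Rb; rewrite inE => /andP[/negPf-> _]; rewrite subr0.
Qed.

End Split.

Lemma acyclic0 d : acyclic d set0.
Proof. by move=> v _; exists v => b; rewrite inE. Qed.

(** The differential does not raise [r], so the sets where [r a < n] filter the complex by
    subcomplexes with the level sets as graded pieces; acyclicity climbs the filtration. *)
Lemma acyclic_levels d P (r : T -> nat) : is_complex d P ->
  {in P &, forall a b, d a b != 0 -> (r b <= r a)%N} ->
  (forall n, acyclic d [set a in P | r a == n]) -> acyclic d P.
Proof.
move=> cx rmon lev.
have key n : acyclic d [set a in P | (r a < n)%N].
  elim: n => [|n IHn].
    rewrite (_ : [set a in P | _] = set0); first exact: acyclic0.
    by apply/setP => a; rewrite !inE andbF.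
  have cxn : is_complex d [set a in P | (r a < n.+1)%N].
    apply: (is_complex_sub _ cx).
      by apply/subsetP => a; rewrite inE => /andP[].
    move=> a b; rewrite !inE => /andP[Pa ran] /andP[/nandP[/negP nPb /nPb //|nb] Pb].
    apply/eqP; apply: contraNT nb => /(rmon a b Pa Pb) rba.
    exact: leq_ltn_trans ran.
  apply: (@acyclic_split d _ [set a in P | (r a < n)%N]) => //.
  - by apply/subsetP => a; rewrite !inE => /andP[-> /=] /ltnW.
  - move=> a b; rewrite !inE => /andP[Pa ran] /and3P[nb Pb _].
    rewrite Pb /= in nb; apply/eqP; apply: contraNT nb => /(rmon a b Pa Pb) rba.
    exact: leq_ltn_trans ran.
  rewrite (_ : _ :\: _ = [set a in P | r a == n]) //.
  apply/setP => a; rewrite !inE ltnS; case: (a \in P) => //=.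
  by rewrite -leqNgt -eqn_leq eq_sym.
have := key (\max_a r a).+1; congr acyclic.
by apply/setP => a; rewrite inE ltnS leq_bigmax andbT.
Qed.

Lemma nonzero_homology_summand d deg P Q i : Q \subset P ->
  {in Q & P :\: Q, forall a b, d a b = 0 /\ d b a = 0} ->
  nonzero_homology d deg Q i -> nonzero_homology d deg P i.
Proof.
move=> QP z [v [phi [hv hphi cv cphi nz]]].
have hcut f : concentrated deg Q i f -> concentrated deg P i (cut Q f).
  by move=> hf a _; rewrite /cut; case: ifP; [exact: hf | rewrite eqxx].
have ccut d' f : {in Q & P :\: Q, forall a b, d' a b = 0} ->
    cycle_on d' Q f -> cycle_on d' P (cut Q f).
  move=> z' cf b Pb; rewrite bd_cut //; have [Qb|nQb] := boolP (b \in Q); first exact: cf.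
  by rewrite /bd big1 // => a Qa; rewrite z' ?mulr0 // inE nQb.
exists (cut Q v), (cut Q phi); split; try exact: hcut.
- by apply: ccut => // a b Qa Rb; case: (z a b).
- by apply: ccut => // a b Qa Rb; case: (z a b).
apply: contra nz; rewrite (big_setID Q) /= (setIidPr QP) [X in _ + X]big1 ?addr0.
  by move/eqP=> e; apply/eqP; rewrite -[RHS]e; apply: eq_bigr => a; rewrite /cut => ->.
by move=> a; rewrite inE /cut => /andP[/negPf-> _]; rewrite mul0r.
Qed.

(** The complex is the direct sum of the fibres of [f]. The pairing of a cycle with a cocycle is the
    sum of the pairings on the fibres, so one of these is non-zero. *)
Lemma nonzero_homology_partition d deg P i (I : finType) (f : T -> I) :
  {in P &, forall a b, d a b != 0 -> f a = f b} ->
  nonzero_homology d deg P i <->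
  exists j, nonzero_homology d deg [set a in P | f a == j] i.
Proof.
move=> fd; split=> [[v [phi [hv hphi cv cphi nz]]]|[j]]; last first.
  apply: nonzero_homology_summand => [|a b].
    by apply/subsetP => a; rewrite inE => /andP[].
  rewrite !inE => /andP[Pa /eqP fa] /andP[fb Pb]; rewrite Pb /= in fb.
  by split; apply/eqP; apply: contraNT fb => /fd e; rewrite -fa ?e // -e.
have [j nzj] : exists j, \sum_(a in [set a in P | f a == j]) v a * phi a != 0.
  apply/existsP; rewrite -negb_forall; apply: contra nz => /forallP z.
  rewrite (partition_big f predT) //= big1 // => j _; rewrite -[RHS](eqP (z j)).
  by apply: eq_bigl => a; rewrite inE.
have sub a : a \in [set a in P | f a == j] -> a \in P by rewrite inE => /andP[].
have ccut d' g : {in P &, forall a b, d' a b != 0 -> f a = f b} ->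
    cycle_on d' P g -> cycle_on d' [set a in P | f a == j] g.
  move=> fd' cg b jb; rewrite -[RHS](cg b (sub b jb)); symmetry; apply: bd_sub.
    exact/subsetP.
  move=> a; rewrite !inE => /andP[ja Pa]; rewrite Pa /= in ja.
  apply/eqP; rewrite mulf_eq0; apply/orP; right; apply: contraNT ja => /fd' -> //.
    by move: jb; rewrite inE => /andP[].
  exact: sub.
exists j, v, phi; split=> //.
- by move=> a /sub; apply: hv.
- by move=> a /sub; apply: hphi.
- exact: ccut.
- by apply: ccut => // a b Pa Pb /fd ->.
Qed.

End BasedComplex.

Lemma nonzero_homology_transpose (k : fieldType) (T : finType) (d : T -> T -> k)
    deg P i :
  nonzero_homology d deg P i -> nonzero_homology (fun a b => d b a) deg P i.
Proof.
move=> [v [phi [hv hphi cv cphi nz]]]; exists phi, v; split=> //.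
by under eq_bigr do rewrite mulrC.
Qed.

(* [f] relabels the basis and [g] rescales it. *)
Lemma nonzero_homology_transport (k : fieldType) (T T' : finType)
    (d : T -> T -> k) (d' : T' -> T' -> k) deg deg' (P : {set T}) (P' : {set T'})
    (f : T -> T') (f' : T' -> T) (g : T -> k) i i' :
  {in P, forall a, f a \in P' /\ f' (f a) = a} ->
  {in P', forall b, f' b \in P /\ f (f' b) = b} ->
  {in P, forall a, g a != 0} ->
  {in P &, forall a b, g a * d' (f a) (f b) = d a b * g b} ->
  {in P, forall a, deg a = i -> deg' (f a) = i'} ->
  nonzero_homology d deg P i -> nonzero_homology d' deg' P' i'.
Proof.
move=> fP f'P g0 gd degP [v [phi [hv hphi cv cphi nz]]].
have sumE (F : T' -> k) : \sum_(b in P') F b = \sum_(a in P) F (f a).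
  rewrite (reindex_onto f f') => [|b /f'P[]//].
  apply: eq_bigl => a; apply/andP/idP => [[/f'P[Pa _] /eqP<-]//|Pa].
  by have [-> ->] := fP a Pa.
(* The cycle is multiplied by [g] and the cocycle divided by it, which leaves the pairing
   unchanged. *)
exists (fun b => v (f' b) * g (f' b)), (fun b => phi (f' b) / g (f' b)); split.
- move=> b /f'P[Pb <-]; have [_ ->] := fP _ Pb.
  by rewrite mulf_eq0 negb_or => /andP[/hv hvb _]; apply/degP/hvb.
- move=> b /f'P[Pb <-]; have [_ ->] := fP _ Pb.
  by rewrite mulf_eq0 negb_or => /andP[/hphi hvb _]; apply/degP/hvb.
- move=> b /f'P[Pb <-]; rewrite /bd sumE.
  transitivity (bd d P v (f' b) * g (f' b)); last by rewrite cv ?mul0r.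
  rewrite mulr_suml.
  apply: eq_bigr => a Pa; have [_ ->] := fP _ Pa.
  by rewrite -mulrA gd // mulrA.
- move=> b /f'P[Pb <-]; rewrite /bd sumE; apply/eqP.
  rewrite -(mulrI_eq0 _ (lregP (g0 _ Pb))) mulr_sumr; apply/eqP.
  rewrite -[RHS](cphi _ Pb); apply: eq_bigr => a Pa; have [_ ->] := fP _ Pa.
  by rewrite mulrCA gd // mulrACA mulVf ?g0 ?mulr1.
rewrite sumE; apply: contra nz => /eqP e; apply/eqP; rewrite -[RHS]e.
apply: eq_bigr => a Pa.
by have [_ ->] := fP _ Pa; rewrite mulrACA mulfV ?g0 ?mulr1.
Qed.

(** * Complexes of families of finite sets *)

Section SetComplex.
Variables (k : fieldType) (X : finType).
Implicit Types (s : {set X} -> X -> k) (a b c U Y : {set X}) (P Q : {set {set X}}).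

(** The abstract form of simplicial signs: deleting two elements in the two orders must cancel.
    Relabelling or complementing sets turns [sgn] into other systems of this kind. *)
Definition sign_system Y s :=
  {in powerset Y, forall a, {in a, forall x, s a x != 0} /\
    {in a &, forall x y, x != y -> s a x * s (a :\ x) y + s a y * s (a :\ y) x = 0}}.

Definition del s a b : k := \sum_(x in a | b == a :\ x) s a x.

Definition card_deg a := #|a|.

Definition sgn a (x : X) : k :=
  (-1) ^+ #|[set y in a | (enum_rank y < enum_rank x)%N]|.

Lemma setD1_inj a x y : x \in a -> a :\ x = a :\ y -> x = y.
Proof.
move=> ax /setP/(_ x); rewrite !inE eqxx ax andbT.
by case: eqP => // ->.
Qed.

Lemma delE s a x : x \in a -> del s a (a :\ x) = s a x.
Proof.
move=> ax; rewrite /del (bigD1 x) ?ax ?eqxx //= big1 ?addr0 // => y.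
by move=> /andP[/andP[ay /eqP/(setD1_inj ax)<-]]; rewrite eqxx.
Qed.

Lemma del_neq0 s a b : del s a b != 0 -> exists2 x, x \in a & b = a :\ x.
Proof.
have [/existsP[x /andP[ax /eqP->]] _|/existsPn nx] := boolP [exists x in a, b == a :\ x].
  by exists x.
by rewrite /del big1 ?eqxx // => x /andP[ax bx]; case/andP: (nx x).
Qed.

Lemma del_graded s : graded_by (del s) card_deg.
Proof. by move=> a b /del_neq0[x ax ->]; rewrite /card_deg (cardsD1 x) ax. Qed.

Lemma del_sub s a b : del s a b != 0 -> b \subset a.
Proof. by move=> /del_neq0[x _ ->]; apply: subsetDl. Qed.

(** Such families are differences of two simplicial complexes, so deletion restricted to them gives
    relative chains. *)
Definition convex P := forall a b c, a \in P -> c \in P -> c \subset b -> b \subset a -> b \in P.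

Lemma sum_antisym (I : finType) (A : {set I}) (F : I -> I -> k) :
  {in A &, forall x y, x != y -> F x y + F y x = 0} ->
  \sum_(x in A) \sum_(y in A | y != x) F x y = 0.
Proof.
move=> antiF; pose lt (x y : I) := (enum_rank x < enum_rank y)%N.
have split2 x y : (y != x) = lt x y || lt y x.
  by rewrite /lt -neq_ltn -(inj_eq enum_rank_inj) -(inj_eq val_inj) /= eq_sym.
transitivity (\sum_(x in A) \sum_(y in A | lt x y) F x y +
              \sum_(x in A) \sum_(y in A | lt y x) F x y).
  rewrite -big_split; apply: eq_bigr => x Ax /=.
  rewrite (bigID (lt x)) /=; congr (_ + _); apply: eq_bigl => y.
    by rewrite split2; case: (lt x y); rewrite ?andbT ?andbF.
  rewrite split2 /lt; case: ltngtP; rewrite ?andbT ?andbF //.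
rewrite [X in _ + X](exchange_big_dep (mem A)) /=; last by move=> x y _ /andP[].
rewrite -big_split big1 // => x Ax /=.
rewrite [X in _ + X](eq_bigl (fun y => (y \in A) && lt x y)); last first.
  by move=> y; rewrite Ax.
rewrite -big_split big1 // => y /andP[Ay ltxy] /=.
by apply: antiF => //; rewrite eq_sym split2 ltxy.
Qed.

Lemma in_powersetT a : a \in powerset setT.
Proof. by rewrite powersetE subsetT. Qed.

Lemma del_complex s P : sign_system setT s -> convex P -> is_complex (del s) P.
Proof.
move=> ss cP a c Pa Pc.
have [sa0 ssa] := ss a (in_powersetT a).
transitivity (\sum_(x in a) \sum_(y in a | y != x)
   if c == a :\ x :\ y then s a x * s (a :\ x) y else 0); last first.
  apply: sum_antisym => x y ax ay xy.
  by rewrite setDDl setUC -setDDl; case: eqP => _; rewrite ?addr0 // ssa.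
have stepE b : del s a b * del s b c =
    \sum_(x in a) if b == a :\ x then s a x * del s b c else 0.
  by rewrite {1}/del mulr_suml [LHS]big_mkcondr.
rewrite (eq_bigr _ (fun b _ => stepE b)) exchange_big; apply: eq_bigr => x ax /=.
have [Pax|nPax] := boolP (a :\ x \in P).
  rewrite (bigD1 (a :\ x)) //= eqxx big1 ?addr0; last first.
    by move=> b /andP[_ /negPf->].
  rewrite /del mulr_sumr [LHS]big_mkcondr; apply: eq_big => [y|y _].
    by rewrite !inE andbC.
  by [].
(* If [c] were a face of [a :\ x], convexity would put [a :\ x] in [P]; so nothing is lost when it
   lies outside. *)
rewrite big1 => [|b Pb]; last by case: eqP => // eb; rewrite -eb Pb in nPax.
rewrite big1 // => y /andP[ay yx]; case: eqP => // ec.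
case/negP: nPax; apply: cP Pa Pc _ _; last exact: subsetDl.
by rewrite ec subsetDl.
Qed.

(** For [x] before [y], removing [y] leaves the number of elements before [x] unchanged, while
    removing [x] lowers the number before [y] by one. *)
Lemma sgn_system Y : sign_system Y sgn.
Proof.
move=> a _; split=> [x ax|]; first by rewrite /sgn signr_eq0.
pose lt (x y : X) := (enum_rank x < enum_rank y)%N.
have key x y : x \in a -> y \in a -> lt x y ->
    sgn a x * sgn (a :\ x) y + sgn a y * sgn (a :\ y) x = 0.
  move=> ax ay ltxy.
  have -> : sgn (a :\ y) x = sgn a x.
    congr (_ ^+ _); apply: eq_card => z; rewrite !inE.
    by case: (z =P y) => // ->; rewrite ltnNge ltnW ?andbF.
  have -> : sgn a y = - sgn (a :\ x) y.
    rewrite /sgn (cardsD1 x) inE ax [(_ < _)%N]ltxy /= exprS mulN1r.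
    by congr (- (_ ^+ _)); apply: eq_card => z; rewrite !inE andbA.
  by rewrite mulNr [X in _ - X]mulrC subrr.
move=> x y ax ay; rewrite -(inj_eq enum_rank_inj) -(inj_eq val_inj) neq_ltn => /orP[]lt'.
  exact: key.
by rewrite addrC key.
Qed.

(* Two sign systems differ by the coboundary of a function [g]: their ratio is
   path-independent because both anticommute around squares. *)
Lemma sign_gauge Y s s' : sign_system Y s -> sign_system Y s' ->
  exists g : {set X} -> k, {in powerset Y, forall a, g a != 0 /\
    {in a, forall x, g a * s' a x = s a x * g (a :\ x)}}.
Proof.
move=> ss ss'.
suff main n : exists g : {set X} -> k, {in powerset Y, forall a, (#|a| <= n)%N ->
    g a != 0 /\ {in a, forall x, g a * s' a x = s a x * g (a :\ x)}}.
  by have [g hg] := main #|X|; exists g => a Ya; apply: hg => //; apply: max_card.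
elim: n => [|n [g hg]].
  exists (fun _ => 1) => a _; rewrite leqn0 cards_eq0 => /eqP->.
  by split=> [|x]; rewrite ?oner_eq0 ?inE.
pose r a x := s a x / s' a x.
(* On sets of size [n.+1] the value is forced by the deletion of one arbitrarily picked element; the
   rest shows that every other deletion forces the same value. *)
exists (fun a => if (#|a| <= n)%N then g a else
  if [pick x in a] is Some x then g (a :\ x) * r a x else 1).
move=> a Ya; rewrite leq_eqVlt => /predU1P[an|an]; last first.
  rewrite ltnS in an; rewrite an; have [ga0 ga] := hg a Ya an; split=> // x ax; rewrite ga //.
  by rewrite (leq_trans _ an) // subset_leq_card // subsetDl.
have Yx x : a :\ x \in powerset Y.
  by move: Ya; rewrite !powersetE; apply: subset_trans (subsetDl _ _).
have cx x : x \in a -> (#|a :\ x| <= n)%N by move=> ax; rewrite -ltnS -an (cardsD1 x a) ax.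
have [sa0 ssa] := ss a Ya; have [sa0' ssa'] := ss' a Ya.
rewrite an ltnn; case: pickP => [z az|a0]; last first.
  by move: an; rewrite (eq_card0 a0).
split=> [|x ax].
  by rewrite !mulf_neq0 ?invr_eq0 ?sa0 ?sa0' //; case: (hg _ (Yx z) (cx z az)).
rewrite cx //; have [->|xz] := eqVneq x z; first by rewrite -mulrA divfK ?sa0' // mulrC.
have [gz0 gz] := hg _ (Yx z) (cx z az); have [gx0 gx] := hg _ (Yx x) (cx x ax).
have zx : z \in a :\ x by rewrite !inE eq_sym xz.
have xz' : x \in a :\ z by rewrite !inE xz.
(* The two facets [a :\ z] and [a :\ x] are compared through their common face, where the induction
   hypothesis applies to both. *)
have Eg : g (a :\ z) * s' (a :\ z) x * s (a :\ x) z =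
          g (a :\ x) * s' (a :\ x) z * s (a :\ z) x.
  by rewrite gz // gx // !setDDl [[set x] :|: _]setUC; ring.
have sq := ssa x z ax az; have sq' := ssa' x z ax az.
have {}sq := sq xz; have {}sq' := sq' xz.
have u0 : s' (a :\ x) z != 0 by case: (ss' _ (Yx x)) => ->.
have w0 : s (a :\ z) x != 0 by case: (ss _ (Yx z)) => ->.
suff E : g (a :\ z) * s a z * s' a x = s a x * g (a :\ x) * s' a z.
  by rewrite -[RHS](mulfK (sa0' z az)) -E /r; field; rewrite sa0'.
apply: (mulIf (mulf_neq0 u0 w0)); apply/eqP; rewrite -subr_eq0; apply/eqP.
transitivity (g (a :\ z) * s' a x * s' (a :\ x) z *
                (s a x * s (a :\ x) z + s a z * s (a :\ z) x)
  - g (a :\ z) * s a x * s (a :\ x) z *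
      (s' a x * s' (a :\ x) z + s' a z * s' (a :\ z) x)
  + s a x * s' a z * (g (a :\ z) * s' (a :\ z) x * s (a :\ x) z -
                      g (a :\ x) * s' (a :\ x) z * s (a :\ z) x)); first ring.
by rewrite sq sq' Eg; ring.
Qed.

Variant del_spec s s' a b : k -> k -> Prop :=
  | DelFace x of x \in a & b = a :\ x : del_spec s s' a b (s a x) (s' a x)
  | DelNone of (forall x, x \in a -> b <> a :\ x) : del_spec s s' a b 0 0.

Lemma delP s s' a b : del_spec s s' a b (del s a b) (del s' a b).
Proof.
have [/existsP[x /andP[ax /eqP eb]]|/existsPn nx] := boolP [exists x in a, b == a :\ x].
  have e s1 : del s1 a b = s1 a x by rewrite eb delE.
  by rewrite !e; apply: DelFace.
have z s1 : del s1 a b = 0.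
  by apply: big1 => x /andP[ax bx]; have := nx x; rewrite ax bx.
by rewrite !z; apply: DelNone => x ax eb; have := nx x; rewrite ax eb eqxx.
Qed.

Lemma del_gauge Y s s' : sign_system Y s -> sign_system Y s' ->
  exists g : {set X} -> k, {in powerset Y, forall a, g a != 0} /\
    {in powerset Y &, forall a b, g a * del s' a b = del s a b * g b}.
Proof.
move=> ss ss'; have [g hg] := sign_gauge ss ss'; exists g.
split=> [a /hg[]//|a b Ya _]; have [_ ga] := hg a Ya.
by case: (delP s s' a b) => [x ax ->|_]; rewrite ?ga ?mulr0 ?mul0r.
Qed.

(** * Contracting a family by adding and removing a chosen element *)

Section Toggle.
Variables (s : {set X} -> X -> k) (P : {set {set X}}) (c : {set X} -> X).
Hypotheses (ss : sign_system setT s) (cP : convex P).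
Hypothesis toggleP : {in P, forall a, (c a |: a \in P) /\ (a :\ c a \in P)}.
Hypothesis c_del : {in P, forall a, {in a, forall x, a :\ x \in P -> c (a :\ x) = c a}}.

(** The contracting homotopy of a cone, with an apex [c a] that may depend on the set. *)
Definition toggle (v : {set X} -> k) a :=
  if c a \in a then v (a :\ c a) / s a (c a) else 0.

(** The difference [u] of the two sides is a cycle. It vanishes at a set [b] without its apex,
    because only [c b |: b] contributes there; the cycle condition at [b :\ c b] then makes it
    vanish at a set [b] with its apex. *)
Lemma toggle_boundary v : cycle_on (del s) P v ->
  {in P, forall b, v b = bd (del s) P (toggle v) b}.
Proof.
move=> cv; have cx := del_complex ss cP.
have s0 a x : x \in a -> s a x != 0.
  by move=> ax; have [-> //] := ss (in_powersetT a).
have c_eq a b : a \in P -> b \in P -> del s a b != 0 -> c b = c a.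
  by move=> Pa Pb /del_neq0[x ax eb]; rewrite eb c_del // -eb.
have uniq a b : a \in P -> b \in P -> c b \notin b -> c a \in a -> del s a b != 0 ->
    a = c b |: b.
  move=> Pa Pb cb ca dab; have cab := c_eq a b Pa Pb dab.
  have [x ax eb] := del_neq0 dab; rewrite cab eb.
  have -> : c a = x by apply/eqP; apply: contraNT cb => cx'; rewrite cab eb !inE cx' ca.
  by rewrite setD1K.
pose u b := v b - bd (del s) P (toggle v) b.
have cu : cycle_on (del s) P u.
  by move=> b Pb; rewrite /u bdB cv // bd_bd // subrr.
have u0 b : b \in P -> c b \notin b -> u b = 0.
  move=> Pb cb; have [Pcb _] := toggleP Pb; have bE : (c b |: b) :\ c b = b by rewrite setU1K.
  have cE : c (c b |: b) = c b.
    by rewrite -[in RHS]bE c_del ?setU11 ?bE.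
  rewrite /u /bd (bigD1 (c b |: b)) //= big1 ?addr0 => [|a /andP[Pa ne]].
    have := delE s (setU11 (c b) b); rewrite bE => ->.
    by rewrite /toggle cE setU11 bE divfK ?s0 ?setU11 // subrr.
  rewrite /toggle; case: ifP => [ca|_]; last by rewrite mul0r.
  apply/eqP; rewrite mulf_eq0; apply/orP; right; apply: contraNT ne => dab.
  by apply/eqP; apply: uniq.
move=> b Pb; apply/eqP; rewrite -subr_eq0 -/(u b).
have [cb|/u0->//] := boolP (c b \in b).
have [_ Pc] := toggleP Pb; have cE : c (b :\ c b) = c b by rewrite c_del.
have := cu _ Pc; rewrite /bd (bigD1 b) //= delE // big1 ?addr0 => [/eqP|a /andP[Pa ne]].
  by rewrite mulf_eq0 (negPf (s0 _ _ cb)) orbF.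
have [ca|/u0->//] := boolP (c a \in a); last by rewrite mul0r.
apply/eqP; rewrite mulf_eq0; apply/orP; right; apply: contraNT ne => dab.
by rewrite (uniq _ _ Pa Pc _ ca dab) cE ?setD1K // !inE eqxx.
Qed.

End Toggle.

Lemma convex_level P (r : {set X} -> nat) n : convex P ->
  (forall a b, a \subset b -> (r a <= r b)%N) -> convex [set a in P | r a == n].
Proof.
move=> cP mr a b c; rewrite !inE => /andP[Pa /eqP ra] /andP[Pc /eqP rc] cb ba.
by rewrite (cP a b c) // eqn_leq -{1}ra -rc !mr.
Qed.

(* Induction on [a :&: A] reduces to toggling one fixed vertex. *)
Lemma acyclic_toggle s P (A : {set X}) (c : {set X} -> X) :
  sign_system setT s -> convex P ->
  {in P, forall a, [/\ c (a :&: A) \notin A, c (a :&: A) |: a \in P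
                     & a :\ c (a :&: A) \in P]} ->
  acyclic (del s) P.
Proof.
move=> ss cP tP; pose r a := #|a :&: A|.
have rmon a b : a \subset b -> (r a <= r b)%N.
  by move=> ab; apply: subset_leq_card; apply: setSI.
apply: (@acyclic_levels _ _ _ _ r); first exact: del_complex.
  by move=> a b _ _ /del_sub/rmon.
move=> n v cv; set L := [set a in P | r a == n] in cv *.
exists (toggle s (fun a => c (a :&: A)) v); apply: toggle_boundary cv => //.
- exact: convex_level.
- move=> a; rewrite !inE => /andP[Pa ra]; have [cA Pu Pd] := tP a Pa.
  have AU : (c (a :&: A) |: a) :&: A = a :&: A.
    by apply/setP => x; rewrite !inE; case: eqP => // ->; rewrite (negPf cA) !andbF.
  have AD : (a :\ c (a :&: A)) :&: A = a :&: A.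
    by apply/setP => x; rewrite !inE; case: eqP => // ->; rewrite (negPf cA) !andbF.
  by rewrite Pu Pd /r AU AD.
(* Inside one level a deletion cannot shrink the intersection with [A], so the apex does not
   change. *)
- move=> a; rewrite inE => /andP[Pa /eqP ra] x ax; rewrite inE => /andP[_ rx].
  have ge : (#|a :&: A| <= #|(a :\ x) :&: A|)%N by rewrite -/(r a) -/(r (a :\ x)) ra (eqP rx).
  congr c; apply/eqP; rewrite eqEcard ge andbT.
  by apply: setSI; apply: subsetDl.
Qed.

(** The degree is the cardinality, one more than the simplicial dimension, and the empty set counts;
    on a simplicial complex this is reduced homology in dimension [i - 1]. *)
Definition NZ P i := nonzero_homology (del sgn) card_deg P i.

End SetComplex.

(** Relabelling by [f] and adjoining the fixed set [N] preserves which sets are deletions of which.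
    Only the signs change, and the pulled-back signs form a sign system, hence are equivalent to
    [sgn] by rescaling. *)
Lemma NZ_image (k : fieldType) (X X' : finType) (f : X -> X') (Y : {set X})
    (N : {set X'}) (P : {set {set X}}) (P' : {set {set X'}}) i :
  injective f -> {in Y, forall x, f x \notin N} -> P \subset powerset Y ->
  {in powerset Y, forall a : {set X}, (f @: a :|: N \in P') = (a \in P)} ->
  {in P', forall b : {set X'}, exists2 a : {set X}, a \subset Y & b = f @: a :|: N} ->
  NZ k P i <-> NZ k P' (i + #|N|).
Proof.
move=> f_inj YN PY PP' P'f.
pose F (a : {set X}) := f @: a :|: N; pose F' (b : {set X'}) := f @^-1: (b :\: N).
have FK (a : {set X}) : a \subset Y -> F' (F a) = a.
  move=> aY; apply/setP => x; rewrite !inE mem_imset //.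
  have [ax|nax] /= := boolP (x \in a); last by case: (_ \in N).
  by rewrite YN // (subsetP aY).
have F'K (b : {set X'}) : b \in P' -> F (F' b) = b.
  by move=> /P'f[a aY ->]; rewrite FK.
have F'P (b : {set X'}) : b \in P' -> F' b \in P.
  by move=> Pb; have [a aY eb] := P'f b Pb; rewrite eb FK // -PP' ?powersetE // -eb.
have F1 (a : {set X}) x : x \in a -> a \subset Y -> F a :\ f x = F (a :\ x).
  move=> ax aY; apply/setP => y; rewrite !inE.
  have [yN|yN] := boolP (y \in N).
    rewrite !orbT andbT; apply: contraTneq yN => ->; apply: YN; exact: (subsetP aY).
  rewrite !orbF; apply/andP/imsetP => [[yx /imsetP[z az ey]]|[z]].
    by exists z; rewrite // !inE az andbT; apply: contra yx => /eqP <-; apply/eqP.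
  rewrite !inE => /andP[zx az] ->; rewrite (inj_eq f_inj) zx; split=> //.
  exact: imset_f.
pose s1 (a : {set X}) x := sgn k (F a) (f x).
have ss1 : sign_system Y s1.
  move=> a; rewrite powersetE => aY.
  have [s0 s2] := @sgn_system k X' setT (F a) (in_powersetT _).
  have inF x : x \in a -> f x \in F a by move=> ax; rewrite !inE imset_f.
  split=> [x ax|x y ax ay xy]; first exact: s0 (inF x ax).
  by rewrite /s1 -!F1 // s2 ?inF // (inj_eq f_inj).
have delF (a b : {set X}) : a \subset Y -> b \subset Y ->
    del (@sgn k X') (F a) (F b) = del s1 a b.
  move=> aY bY; case: (delP s1 s1 a b) => [x ax ->|nx].
    by rewrite -F1 // delE // !inE imset_f.
  apply/eqP; apply: contraT => /del_neq0[y]; rewrite !inE => /orP[/imsetP[x ax ->]|yN eF].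
    rewrite F1 // => /(congr1 F'); rewrite !FK //; first by move/nx; case.
    by apply: subset_trans aY; apply: subsetDl.
  have : y \in F b by rewrite !inE yN orbT.
  by rewrite eF !inE eqxx.
have [g [g0 hg]] := del_gauge (@sgn_system k X Y) ss1.
have [g' [g'0 hg']] := del_gauge ss1 (@sgn_system k X Y).
have PYs (a : {set X}) : a \in P -> a \subset Y by move=> /(subsetP PY); rewrite powersetE.
have cardF (a : {set X}) : a \subset Y -> #|F a| = (#|a| + #|N|)%N.
  move=> aY; rewrite cardsU card_imset // (_ : _ :&: _ = set0) ?cards0 ?subn0 //.
  apply/setP => y; rewrite !inE; apply/negP => /andP[/imsetP[x ax ->] yN].
  by move: (YN x (subsetP aY x ax)); rewrite yN.
split.
- apply: (@nonzero_homology_transport _ _ _ _ _ _ _ _ _ F F' g) => [a Pa|b Pb|a Pa|a b Pa Pb|a Pa].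
  + by rewrite FK ?PYs // PP' // powersetE PYs.
  + by rewrite F'P ?F'K.
  + exact/g0/(subsetP PY).
  + by rewrite delF ?PYs // hg ?(subsetP PY).
  + by rewrite /card_deg cardF ?PYs // => ->.
apply: (@nonzero_homology_transport _ _ _ _ _ _ _ _ _ F' F (fun b => g' (F' b))) =>
    [b Pb|a Pa|b Pb|b c Pb Pc|b Pb].
- by rewrite F'P ?F'K.
- by rewrite FK ?PYs // PP' // powersetE PYs.
- exact/g'0/(subsetP PY)/F'P.
- have := delF _ _ (PYs _ (F'P b Pb)) (PYs _ (F'P c Pc)); rewrite !F'K // => ->.
  by rewrite hg' ?(subsetP PY) ?F'P.
- rewrite /card_deg -[in #|b|](F'K b Pb) cardF ?PYs ?F'P //; exact: addIn.
Qed.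

Lemma NZ_le (k : fieldType) (X : finType) (U : {set X}) (P : {set {set X}}) i :
  P \subset powerset U -> NZ k P i -> (i <= #|U|)%N.
Proof.
move=> PU /nonzero_homology_cell[a Pa <-]; apply: subset_leq_card.
by have := subsetP PU a Pa; rewrite powersetE.
Qed.

(** Combinatorial Alexander duality: complementation in [U] reverses inclusion, so it transposes the
    differential up to rescaling, and non-vanishing is invariant under transposition. *)
Lemma NZ_complement (k : fieldType) (X : finType) (U : {set X})
    (P P' : {set {set X}}) i :
  P \subset powerset U -> P' \subset powerset U ->
  {in powerset U, forall a : {set X}, (U :\: a \in P') = (a \in P)} ->
  NZ k P i -> NZ k P' (#|U| - i).
Proof.
move=> PU P'U PP' /nonzero_homology_transpose.
have CK (a : {set X}) : a \in powerset U -> U :\: (U :\: a) = a.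
  by rewrite powersetE => aU; rewrite setDDr setDv set0U; apply/setIidPr.
have CU (a : {set X}) : U :\: a \in powerset U by rewrite powersetE subsetDl.
(* The sign with which deleting [x] from the complement of [a :\ x] gives the complement of [a]. *)
pose s1 (a : {set X}) x := sgn k (U :\: (a :\ x)) x.
have inC (a : {set X}) x : x \in a -> a \in powerset U -> x \in U :\: (a :\ x).
  by rewrite powersetE => ax aU; rewrite !inE eqxx /= (subsetP aU).
have Ud (a : {set X}) x : a \in powerset U -> a :\ x \in powerset U.
  by rewrite !powersetE; apply: subset_trans (subsetDl _ _).
have ss1 : sign_system U s1.
  move=> a Ua; split=> [x ax|x y ax ay xy].
    by have [-> //] := @sgn_system k X setT _ (in_powersetT (U :\: (a :\ x))); apply: inC.
  have [_ s2] := @sgn_system k X setT _ (in_powersetT (U :\: (a :\ x :\ y))).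
  have step x' y' : x' != y' -> y' \in a -> U :\: (a :\ x') = U :\: (a :\ x' :\ y') :\ y'.
    move=> ne ay'; apply/setP => z; rewrite !inE; case: (z =P y') => //= ->.
    by rewrite eq_sym ne ay'.
  have sw : a :\ y :\ x = a :\ x :\ y by rewrite !setDDl [[set y] :|: _]setUC.
  rewrite /s1 [U :\: (a :\ x)](step x y) // [U :\: (a :\ y)](step y x) 1?eq_sym // sw.
  rewrite mulrC [X in _ + X]mulrC s2 1?eq_sym //.
  - by apply: inC; rewrite ?Ud // !inE eq_sym xy ay.
  - by rewrite -sw; apply: inC; rewrite ?Ud // !inE xy ax.
have delC (a b : {set X}) : a \in powerset U -> b \in powerset U ->
    del (@sgn k X) (U :\: b) (U :\: a) = del s1 a b.
  move=> Ua Ub; case: (delP s1 s1 a b) => [x ax ->|nx].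
    have -> : U :\: a = U :\: (a :\ x) :\ x.
      by apply/setP => z; rewrite !inE; case: (z =P x) => //= ->; rewrite ax.
    by rewrite delE ?inC.
  apply/eqP; apply: contraT => /del_neq0[x]; rewrite inE => /andP[nbx Ux] /setP e.
  have {e} e z : (z \in a) = (z == x) || (z \in b).
    have := e z; rewrite !inE; move: Ua Ub.
    rewrite !powersetE => /subsetP/(_ z) za /subsetP/(_ z) zb.
    have [->|_] := eqVneq z x; first by rewrite Ux andbT => /negbFE.
    case: (z \in U) za zb => [_ _|za zb _]; first by rewrite !andbT => /negb_inj.
    by move: za zb; case: (z \in a) => [/(_ isT)//|_]; case: (z \in b) => [/(_ isT)|].
  case: (nx x); first by rewrite e eqxx.
  by apply/setP => z; rewrite !inE e; case: eqP => //= ->; apply: negPf.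
have [g [g0 hg]] := del_gauge ss1 (@sgn_system k X U).
have sub' (a : {set X}) : a \in P -> U :\: a \in P' by move=> Pa; rewrite PP' // (subsetP PU).
apply: (@nonzero_homology_transport _ _ _ _ _ _ _ _ _ (fun a => U :\: a)
         (fun a => U :\: a) (fun a => g (U :\: a))) => [a Pa|a Pa|a Pa|a b Pa Pb|a Pa].
- by rewrite CK ?(subsetP PU) // sub'.
- by rewrite -PP' // CK ?(subsetP P'U).
- exact: g0.
- by rewrite hg // -delC // !CK ?(subsetP PU).
have := subsetP PU a Pa; rewrite powersetE => aU.
by rewrite /card_deg cardsD (setIidPr aU) => <-.
Qed.

(** * Independent sets of subdivisions *)

Section IndependentSets.
Variable B : sgraph.
Implicit Types (a b U A : {set B}).

Definition independent a := [forall x in a, forall y in a, ~~ adj x y].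

Definition Ind U : {set {set B}} := [set a : {set B} | (a \subset U) && independent a].

Lemma independentP a : reflect {in a &, forall x y, ~~ adj x y} (independent a).
Proof.
apply: (iffP forall_inP) => [h x y /h/forall_inP|h x ax]; first exact.
by apply/forall_inP => y; apply: h.
Qed.

Lemma independent_sub a b : b \subset a -> independent a -> independent b.
Proof.
by move=> /subsetP ba /independentP ia; apply/independentP => x y /ba ax /ba; apply: ia.
Qed.

Lemma Ind_sub U a b : b \subset a -> a \in Ind U -> b \in Ind U.
Proof.
move=> ba; rewrite !inE => /andP[aU /(independent_sub ba)->].
by rewrite (subset_trans ba).
Qed.

Lemma Ind_powerset U : Ind U \subset powerset U.
Proof. by apply/subsetP => a; rewrite !inE => /andP[]. Qed.

Lemma Ind_convex U : convex (Ind U).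
Proof. by move=> a b c Pa _ _ ba; apply: Ind_sub Pa. Qed.

(* For a subdivision, with [A] one of the two sides, this contracts away the
   other side. *)
Lemma NZ_dominating (k : fieldType) U A i : independent (U :\: A) ->
  NZ k (Ind U) i <->
  NZ k [set a in Ind U | (a \subset A) &&
          [forall u in U :\: A, exists v in a, adj u v]] i.
Proof.
(* As [U :\: A] is independent, a free vertex can be added to or removed from [a] at will. The sets
   with a free vertex form the subcomplex [Q], to be shown acyclic. *)
move=> iUA; pose free a u := (u \in U :\: A) && [forall v in a :&: A, ~~ adj u v].
pose Q := [set a in Ind U | [exists u, free a u]].
have QP : Q \subset Ind U by apply/subsetP => a; rewrite inE => /andP[].
have free_sub a b u : b \subset a -> free a u -> free b u.
  move=> ba /andP[uUA /forall_inP h]; rewrite /free uUA; apply/forall_inP => v vb.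
  by apply: h; apply: subsetP vb; apply: setSI.
have cQ : convex Q.
  move=> a b c; rewrite !inE => /andP[/andP[aU ia] /existsP[u fu]] _ _ ba.
  rewrite (subset_trans ba aU) (independent_sub ba ia); apply/existsP; exists u.
  exact: free_sub fu.
(* Without free vertices, each vertex of [U :\: A] has a neighbour in [a], hence is not itself in
   the independent set [a]. *)
have -> : [set a in Ind U | (a \subset A) && [forall u in U :\: A, exists v in a, adj u v]]
          = Ind U :\: Q.
  apply/setP => a; rewrite inE [RHS]inE [in RHS]inE andbC.
  have [Pa|_] := boolP (a \in Ind U); last by rewrite !andbF.
  rewrite /= !andbT; apply/andP/existsPn => [[aA /forall_inP dom] u|nf].
    apply/nandP; have [/dom/exists_inP[v va uv]|] := boolP (u \in U :\: A); last by left.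
    right; apply/forall_inPn; exists v; last by rewrite negbK.
    by rewrite inE va (subsetP aA).
  have dom u : u \in U :\: A -> exists2 v, v \in a :&: A & adj u v.
    move=> uUA; have := nf u; rewrite /free uUA /= => /forall_inPn[v va].
    by rewrite negbK; exists v.
  have [aU /independentP ia] : a \subset U /\ independent a by apply/andP; move: Pa; rewrite inE.
  split.
    apply/subsetP => u ua; apply: contraT => nAu.
    have [|v /setIP[va _]] := dom u; first by rewrite inE nAu (subsetP aU).
    by rewrite (negPf (ia u v ua va)).
  apply/forall_inP => u /dom[v /setIP[va _] uv]; apply/exists_inP; by exists v.
have cxP := del_complex (@sgn_system k B setT) (@Ind_convex U).
have Qsub : {in Q & Ind U :\: Q, forall a b, del (sgn k (X:=B)) a b = 0}.
  move=> x y Qx /setDP[Pb nQb]; move: Qx; rewrite inE => /andP[_ /existsP[u fu]].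
  apply/eqP; apply: contraNT nQb => /del_sub ba; rewrite inE Pb /=.
  by apply/existsP; exists u; apply: free_sub fu.
apply: (nonzero_homology_quotient QP cxP Qsub (@del_graded _ _ _)).
have [->|[a0]] := set_0Vmem Q; first exact: acyclic0.
rewrite inE => /andP[_ /existsP[u0 _]].
(* The toggled vertex must depend on [a :&: A] only, as freeness does; [u0] is a default that is
   never reached on [Q]. *)
apply: (@acyclic_toggle _ _ _ _ A (fun a => odflt u0 [pick u | free a u])) => //.
  exact: sgn_system.
move=> a; rewrite inE => /andP[Pa /existsP[u fu]].
have freeI v : free (a :&: A) v = free a v by rewrite /free -setIA setIid.
case: pickP => /= [v|/(_ u)]; last by rewrite freeI fu.
rewrite freeI => /andP[vUA /forall_inP va]; have /setDP[vU vA] := vUA.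
have fD b : b :&: A = a :&: A -> [exists u, free b u].
  by move=> e; apply/existsP; exists u; rewrite /free e.
split=> //; rewrite inE; last first.
  rewrite (Ind_sub _ Pa) ?subsetDl //=; apply: fD.
  by apply/setP => x; rewrite !inE; case: eqP => // ->; rewrite (negPf vA) !andbF.
rewrite fD ?andbT; last first.
  by apply/setP => x; rewrite !inE; case: eqP => // ->; rewrite (negPf vA) !andbF.
move: Pa; rewrite !inE => /andP[aU /independentP ia].
rewrite subUset sub1set vU aU; apply/independentP.
have vx x : x \in a -> ~~ adj v x.
  move=> xa; have [xA|xA] := boolP (x \in A); first by apply: va; rewrite inE xa.
  by apply: (independentP _ iUA) => //; rewrite inE xA (subsetP aU).
move=> x y /setU1P[->|xa] /setU1P[->|ya]; rewrite ?adj_irr ?vx //.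
  by rewrite adj_sym vx.
exact: ia.
Qed.

End IndependentSets.

(** * The two contractions of a subdivision and Hochster duality *)

Section Incidence.
Variables (k : fieldType) (G : sgraph).
Notation E := {A : {set G} | A \in edges G}.
Implicit Types (W a : {set G}) (c : {set E}).

Definition cover_set c : {set G} := \bigcup_(e in c) val e.

Definition covers W : {set {set E}} := [set c : {set E} | cover_set c == W].

(** The vertex set of S(G[W]) inside S(G), where it induces S(G[W]). *)
Definition incident W : {set subdivision G} :=
  [set u : subdivision G | match u with inl x => x \in W | inr e => val e \subset W end].

(** Contracting the vertex side leaves the sets of edges inside [W] that dominate every vertex of
    [W], that is, have union [W]. *)
Lemma NZ_covers W i : NZ k (covers W) i <-> NZ k (Ind (incident W)) i.
Proof.
rewrite (@NZ_dominating _ k _ [set u : subdivision G | if u is inr _ then true else false]);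
  last first.
  by apply/independentP => -[x|e] [y|f]; rewrite !inE.
rewrite -[in X in _ <-> X](addn0 i) -(@cards0 (subdivision G)).
apply: (@NZ_image _ _ _ (inr : E -> subdivision G) setT) => [x y []//|x _|||b].
- by rewrite inE.
- by apply/subsetP => c _; apply: in_powersetT.
- move=> c _; rewrite setU0 !inE; apply/idP/eqP => [|<-].
    move=> /and3P[/andP[/subsetP cW _] _ /forall_inP dom].
    apply/setP => x; apply/bigcupP/idP => [[e ec]|Wx].
      have := cW (inr e); rewrite inE imset_f // => /(_ isT)/subsetP; exact.
    have := dom (inl x); rewrite !inE => /(_ Wx)/exists_inP[_ /imsetP[e ec ->] xe].
    by exists e.
  apply/and3P; split; first (apply/andP; split).
  + by apply/subsetP => _ /imsetP[e ec ->]; rewrite inE; apply: bigcup_sup.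
  + by apply/independentP => _ _ /imsetP[e _ ->] /imsetP[f _ ->].
  + by apply/subsetP => _ /imsetP[e ec ->]; rewrite inE.
  apply/forall_inP => -[x|e]; rewrite !inE //= => /bigcupP[e ec xe].
  by apply/exists_inP; exists (inr e) => //; apply: imset_f.
rewrite !inE => /and3P[_ /subsetP bA _]; exists (inr @^-1: b); first exact: subsetT.
rewrite setU0; apply/setP => -[x|e].
  by apply/idP/imsetP => [/bA|[]//]; rewrite inE.
by apply/idP/imsetP => [eb|[f]]; [exists e; rewrite ?inE | rewrite inE => fb [->]].
Qed.

Lemma edge_set x y : adj x y -> [set x; y] \in edges G.
Proof.
by move=> xy; rewrite inE; apply/existsP; exists x; apply/existsP; exists y; rewrite xy eqxx.
Qed.

Definition vertex_covers W : {set {set G}} :=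
  [set a in powerset W | independent (W :\: a)].

(** Contracting the edge side leaves the subsets of [W] that meet every edge inside [W]. *)
Lemma NZ_vertex_covers W i :
  NZ k (vertex_covers W) i <-> NZ k (Ind (incident W)) i.
Proof.
rewrite (@NZ_dominating _ k _ [set u : subdivision G | if u is inl _ then true else false]);
  last first.
  by apply/independentP => -[x|e] [y|f]; rewrite !inE.
rewrite -[in X in _ <-> X](addn0 i) -(@cards0 (subdivision G)).
apply: (@NZ_image _ _ _ (inl : G -> subdivision G) setT) => [x y []//|x _|||b].
- by rewrite inE.
- by apply/subsetP => c _; apply: in_powersetT.
- move=> a _; rewrite setU0 !inE; apply/idP/idP.
    move=> /and3P[/andP[/subsetP cW _] _ /forall_inP dom]; apply/andP; split.
      by apply/subsetP => x xa; have := cW (inl x); rewrite inE imset_f // => /(_ isT).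
    apply/independentP => x y /setDP[xW xa] /setDP[yW ya]; apply/negP => xy.
    have := dom (inr (Sub [set x; y] (edge_set xy))).
    rewrite !inE subUset !sub1set xW yW => /(_ isT)/exists_inP[_ /imsetP[z za ->]].
    by rewrite /= !inE => /orP[]/eqP e; rewrite e ?(negPf xa) ?(negPf ya) in za.
  move=> /andP[aW /independentP ia]; apply/and3P; split; first (apply/andP; split).
  + by apply/subsetP => _ /imsetP[e ec ->]; rewrite inE; apply: (subsetP aW).
  + by apply/independentP => _ _ /imsetP[e _ ->] /imsetP[f _ ->].
  + by apply/subsetP => _ /imsetP[e ec ->]; rewrite inE.
  apply/forall_inP => -[x|e]; rewrite !inE //= => eW; apply/exists_inP.
  have := valP e; rewrite inE => /existsP[x /existsP[y /andP[xy /eqP ee]]].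
  have [xe ye] : x \in val e /\ y \in val e by rewrite ee !inE !eqxx orbT.
  have [xa|xa] := boolP (x \in a); first by exists (inl x); rewrite ?imset_f.
  have [ya|ya] := boolP (y \in a); first by exists (inl y); rewrite ?imset_f.
  by have := ia x y; rewrite !inE xa ya !(subsetP eW) // xy => /(_ isT isT).
rewrite !inE => /and3P[_ /subsetP bA _]; exists (inl @^-1: b); first exact: subsetT.
rewrite setU0; apply/setP => -[x|e].
  by apply/idP/imsetP => [eb|[f]]; [exists x; rewrite ?inE | rewrite inE => fb [->]].
by apply/idP/imsetP => [/bA|[]//]; rewrite inE.
Qed.

(** Complements in [W] of independent sets are the vertex covers, so Alexander duality followed by
    the two contractions gives this form of Hochster's formula. *)
Lemma NZ_Ind_covers W i : NZ k (Ind W) i -> NZ k (covers W) (#|W| - i).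
Proof.
move=> h; apply/NZ_covers/NZ_vertex_covers.
apply: NZ_complement h; first exact: Ind_powerset.
  by apply/subsetP => a; rewrite inE => /andP[].
move=> a; rewrite powersetE => aW; rewrite !inE subsetDl aW /=.
by rewrite setDDr setDv set0U (setIidPr aW).
Qed.

Lemma NZ_covers_Ind W i : NZ k (covers W) i -> (i <= #|W|)%N /\ NZ k (Ind W) (#|W| - i).
Proof.
move=> /NZ_covers/NZ_vertex_covers.
have cW : vertex_covers W \subset powerset W.
  by apply/subsetP => a; rewrite inE => /andP[].
move=> h; split; first exact: NZ_le h.
apply: NZ_complement h => //; first exact: Ind_powerset.
by move=> a; rewrite powersetE => aW; rewrite !inE subsetDl aW.
Qed.

End Incidence.

(** * The Taylor resolution *)

Section Taylor.
Variables (k : fieldType) (G : sgraph).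
Notation E := {A : {set G} | A \in edges G}.
Notation R := {mpoly k[#|G|]}.
Implicit Types (c b : {set E}) (v w : {set E} -> R) (m q : 'X_{1..#|G|}).

(** The least common multiple of the edge monomials in [c]. *)
Definition cover_mon c : 'X_{1..#|G|} :=
  [multinom (enum_val i \in cover_set c : nat) | i < #|G|].

Definition support_set m : {set G} := [set x | m (enum_rank x) != 0%N].

Lemma cover_mon_le c m : (cover_mon c <= m)%MM = (cover_set c \subset support_set m).
Proof.
apply/mnm_lepP/subsetP => [h x xc|h i].
  by rewrite inE -lt0n; apply: leq_trans (h _); rewrite mnmE enum_rankK xc.
rewrite mnmE; case: (boolP (_ \in _)) => // /h.
by rewrite inE enum_valK lt0n.
Qed.

Lemma cover_mon_mono c b : b \subset c -> (cover_mon b <= cover_mon c)%MM.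
Proof.
move=> bc; rewrite cover_mon_le; apply/subsetP => x /bigcupP[e eb xe].
rewrite inE mnmE enum_rankK; suff -> : x \in cover_set c by [].
by apply/bigcupP; exists e; rewrite ?(subsetP bc).
Qed.

Lemma cover_set_mono c b : b \subset c -> cover_set b \subset cover_set c.
Proof. by move/subsetP=> bc; apply/bigcupsP => e /bc ec; apply: bigcup_sup. Qed.

Lemma mdeg_cover_mon c : mdeg (cover_mon c) = #|cover_set c|.
Proof.
rewrite mdegE -sum1_card [RHS]big_mkcond /=.
rewrite [RHS](reindex _ (onW_bij _ (enum_val_bij G))).
by apply: eq_bigr => i _; rewrite mnmE; case: (_ \in _).
Qed.

(** The truncated subtraction of exponents is exact wherever it counts: [del] vanishes unless [b] is
    contained in [c], and then the monomial of [b] divides that of [c]. *)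
Definition taylor c b : R := del (@sgn k E) c b *: 'X_[cover_mon c - cover_mon b].

Definition tbd v b : R := \sum_c v c * taylor c b.

(* The degree [m] component of [v], for the multigrading in which the basis
   element [c] has degree [cover_mon c]. *)
Definition strand v m c : k :=
  if (cover_mon c <= m)%MM then (v c)@_(m - cover_mon c) else 0.

Definition below m : {set {set E}} := [set c | (cover_mon c <= m)%MM].

Lemma mcoeffMX_lt (p : R) m q : ~~ (m <= q)%MM -> (p * 'X_[m])@_q = 0.
Proof.
move=> mq; apply/eqP; rewrite mcoeff_eq0 (perm_mem (msuppMX p m)).
by apply: contra mq => /mapP[m' _ ->]; apply: lem_addr.
Qed.

(** The differential respects the multigrading, so in degree [m] it is the scalar deletion complex
    on the sets whose monomial divides [m]. *)
Lemma strand_tbd v m b : (cover_mon b <= m)%MM ->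
  (tbd v b)@_(m - cover_mon b) = bd (del (@sgn k E)) (below m) (strand v m) b.
Proof.
move=> bm; rewrite /tbd raddf_sum /bd [RHS]big_mkcond; apply: eq_bigr => c _ /=.
rewrite /taylor -scalerAr mcoeffZ inE /strand.
have [->|/del_sub/cover_mon_mono bc] := eqVneq (del (@sgn k E) c b) 0.
  by rewrite mul0r; case: ifP; rewrite ?mulr0.
case: ifP => cm.
  have -> : (m - cover_mon b = (cover_mon c - cover_mon b) + (m - cover_mon c))%MM.
    apply/mnmP => i; rewrite !mnmE; move/mnm_lepP/(_ i): bc; move/mnm_lepP/(_ i): cm.
    by rewrite !mnmE => h1 h2; rewrite addnBAC // subnKC.
  by rewrite mcoeffMX cm mulrC.
rewrite mcoeffMX_lt ?mulr0 //; apply: contraFN cm => h.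
apply/mnm_lepP => i; move/mnm_lepP/(_ i): h; move/mnm_lepP/(_ i): bm.
move/mnm_lepP/(_ i): bc; rewrite !mnmE => h1 h2 h3.
by rewrite -(subnK h1) -(subnK h2) leq_add2r.
Qed.

Lemma below_convex m : convex (below m).
Proof.
move=> a b c; rewrite !inE => am _ _ ba.
exact: lepm_trans (cover_mon_mono ba) am.
Qed.

Lemma below_complex m : is_complex (del (@sgn k E)) (below m).
Proof. exact: del_complex (@sgn_system k E setT) (@below_convex m). Qed.

Lemma eq_strand v w : (forall m c, (cover_mon c <= m)%MM -> strand v m c = strand w m c) ->
  v =1 w.
Proof.
move=> h c; apply/mpolyP => q; have := h (q + cover_mon c)%MM c.
by rewrite /strand lem_addl addmK; apply.
Qed.

Lemma strandE v m b : b \in below m ->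
  strand (tbd v) m b = bd (del (@sgn k E)) (below m) (strand v m) b.
Proof. by rewrite inE => bm; rewrite -strand_tbd // /strand bm. Qed.

Lemma tbd_tbd v b : tbd (tbd v) b = 0.
Proof.
apply: (@eq_strand _ (fun _ => 0)) => m c cm; have bc : c \in below m by rewrite inE.
rewrite strandE // (eq_bd _ (@strandE v m)) bd_bd //; last exact: below_complex.
by rewrite /strand cm mcoeff0.
Qed.

(* Multidegree by multidegree the complex is that of a full simplex, which a
   fixed generator dividing [m] contracts. *)
Lemma tbd_exact v : (forall b, tbd v b = 0) -> v set0 = 0 -> exists w, v =1 tbd w.
Proof.
move=> cv v0; pose edge m := [pick e : E | val e \subset support_set m].
pose h m c := if edge m is Some e then toggle (@sgn k E) (fun=> e) (strand v m) c else 0.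
(* The finitely many multidegrees occurring in [v]; [w] is assembled from the contractions of these
   strands. *)
pose L := undup [seq (cover_mon c + q)%MM | c <- enum {set E}, q <- msupp (v c)].
pose w c : R := \sum_(m <- L | (cover_mon c <= m)%MM) h m c *: 'X_[m - cover_mon c].
have strand_L m c : m \notin L -> strand v m c = 0.
  rewrite /strand; case: ifP => // cm mL; apply/eqP; rewrite mcoeff_eq0.
  apply: contra mL => qv; rewrite mem_undup; apply/allpairsPdep.
  by exists c, (m - cover_mon c)%MM; rewrite mem_enum addmC submK.
have strand_w m : {in below m, strand w m =1 h m}.
  move=> c; rewrite inE => cm; rewrite /strand cm /w raddf_sum /=.
  have [mL|nmL] := boolP (m \in L).
    rewrite big_mkcond (bigD1_seq m) ?undup_uniq //= cm mcoeffZ mcoeffX eqxx mulr1.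
    rewrite big1 ?addr0 // => m' ne; case: ifP => // cm'.
    rewrite mcoeffZ mcoeffX; case: eqP => [e|_]; last by rewrite mulr0.
    by case/eqP: ne; rewrite -(submK cm') e submK.
  rewrite big_seq_cond big1 => [|m' /andP[m'L cm']].
    rewrite /h; case: (edge m) => // e; rewrite /toggle; case: ifP => // _.
    by rewrite strand_L // mul0r.
  rewrite mcoeffZ mcoeffX; case: eqP => [e|_]; last by rewrite mulr0.
  by case/negP: nmL; rewrite -(submK cm) -e submK.
exists w; apply: eq_strand => m b bm; have Pb : b \in below m by rewrite inE.
rewrite strandE // (eq_bd _ (strand_w m)).
have cs : cycle_on (del (@sgn k E)) (below m) (strand v m).
  by move=> c Pc; rewrite -strandE // /strand cv mcoeff0 if_same.
have inBelow c : (c \in below m) = [forall e in c, val e \subset support_set m].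
  rewrite inE cover_mon_le; apply/bigcupsP/forall_inP; exact.
rewrite /h /edge; case: pickP => [e em|ne].
  apply: toggle_boundary cs _ Pb; first exact: sgn_system.
  - exact: below_convex.
  - move=> c; rewrite !inBelow => /forall_inP ch; split; apply/forall_inP => f.
      by move=> /setU1P[->|/ch].
    by move=> /setD1P[_ /ch].
  - by [].
(* No generator divides [m], so only the empty set is below [m], and [v] vanishes there by
   hypothesis. *)
rewrite [RHS]big1 => [|c _]; last by rewrite mul0r.
have [->|[e eb]] := set_0Vmem b; first by rewrite /strand v0 mcoeff0 if_same.
by move: Pb; rewrite inBelow => /forall_inP/(_ e eb); rewrite ne.
Qed.

End Taylor.

(** * Row vectors as functions on the sets of a given size *)

Section SizeRows.
Variables (K : nzRingType) (X : finType).
Implicit Types (c : {set X}) (f : {set X} -> K).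

Definition of_size i : {set {set X}} := [set c : {set X} | #|c| == i].

(** The sum has at most one term; this form gives extension by zero to the sets of other sizes. *)
Definition fun_of_row i (v : 'rV[K]_#|of_size i|) c : K := \sum_(a | enum_val a == c) v 0 a.

Definition row_of_fun i f : 'rV[K]_#|of_size i| := \row_a f (enum_val a).

Lemma fun_of_rowE i (v : 'rV_#|of_size i|) a : fun_of_row v (enum_val a) = v 0 a.
Proof.
rewrite /fun_of_row (bigD1 a) //= big1 ?addr0 // => a' /andP[/eqP/enum_val_inj->].
by rewrite eqxx.
Qed.

Lemma fun_of_row_out i (v : 'rV_#|of_size i|) c : #|c| != i -> fun_of_row v c = 0.
Proof.
move=> ci; rewrite /fun_of_row big1 // => a /eqP e.
by move: (enum_valP a); rewrite e inE (negPf ci).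
Qed.

Lemma fun_of_row_of_fun i f c : fun_of_row (row_of_fun i f) c = if #|c| == i then f c else 0.
Proof.
case: ifP => [ci|/negbT]; last exact: fun_of_row_out.
have cS : c \in of_size i by rewrite inE.
by rewrite -(enum_rankK_in cS cS) fun_of_rowE mxE.
Qed.

Lemma of_sizeP i c : #|c| = i -> exists a : 'I_#|of_size i|, c = enum_val a.
Proof.
move=> ci; have cS : c \in of_size i by rewrite inE ci.
by exists (enum_rank_in cS c); rewrite enum_rankK_in.
Qed.

Lemma mulmx_size i j (v : 'rV_#|of_size i|) (M : {set X} -> {set X} -> K) b :
  (v *m (\matrix_(a < _, b < #|of_size j|) M (enum_val a) (enum_val b))) 0 b =
  \sum_c fun_of_row v c * M c (enum_val b).
Proof.
rewrite mxE (bigID (mem (of_size i))) /= [X in _ + X]big1 ?addr0.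
  by rewrite [RHS]big_enum_val; apply: eq_bigr => a _; rewrite fun_of_rowE mxE.
by move=> c; rewrite inE => ci; rewrite fun_of_row_out ?mul0r.
Qed.

End SizeRows.

(** * The Taylor complex as a graded free resolution of R/I *)

Section TaylorResolution.
Variables (k : fieldType) (G : sgraph).
Notation E := {A : {set G} | A \in edges G}.
Notation R := {mpoly k[#|G|]}.
Implicit Types (c b : {set E}).

(** The basis of F_i consists of the sets of [i] edges. In particular F_0 is spanned by the empty
    set, and the augmentation is the identity of R. *)
Definition taylor_seq : graded_seq k #|G| :=
  @GradedSeq k #|G| (fun i => #|of_size E i|)
    (fun i a => #|cover_set (enum_val a)|)
    (fun i => \matrix_(a, b) taylor k (enum_val a) (enum_val b))
    (const_mx 1).

Lemma taylor_neq0 c b : taylor k c b != 0 -> #|c| = #|b|.+1.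
Proof.
apply: contraNeq => cb; rewrite /taylor.
have [->|/del_graded/eqP] := eqVneq (del (@sgn k E) c b) 0; first by rewrite scale0r.
by rewrite /card_deg (negPf cb).
Qed.

Lemma mul_taylor i (v : 'rV[R]_#|of_size E i.+1|) (b : 'I_#|of_size E i|) :
  (v *m gdiff taylor_seq i) 0 b = tbd (fun_of_row v) (enum_val b).
Proof. exact: mulmx_size. Qed.

Lemma tbd_row i (f : {set E} -> R) b : #|b| = i ->
  tbd (fun_of_row (row_of_fun i.+1 f)) b = tbd f b.
Proof.
move=> bi; apply: eq_bigr => c _; rewrite fun_of_row_of_fun; case: eqP => // ci.
have [->|/taylor_neq0] := eqVneq (taylor k c b) 0; first by rewrite !mulr0.
by rewrite bi.
Qed.

Lemma taylor_exact i (v : 'rV[R]_#|of_size E i.+1|) :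
  v *m gdiff taylor_seq i = 0 <-> exists w, v = w *m gdiff taylor_seq i.+1.
Proof.
split=> [vd|[w ->]]; last first.
  apply/rowP => b; rewrite mul_taylor [RHS]mxE -[RHS](tbd_tbd (fun_of_row w) (enum_val b)).
  apply: eq_bigr => c _; congr (_ * _).
  have [ci|ci] := eqVneq #|c| i.+1.
    by have [a ->] := of_sizeP ci; rewrite fun_of_rowE mul_taylor.
  rewrite fun_of_row_out // /tbd big1 // => c' _.
  have [->|/taylor_neq0 e] := eqVneq (taylor k c' c) 0; first by rewrite mulr0.
  by rewrite fun_of_row_out ?mul0r // e.
(* A chain on sets of size [i.+1] has boundary in size [i] only and vanishes at the empty set, so
   ungraded exactness applies; the bounding chain is then cut down to size [i.+2]. *)
have [b||w e] := @tbd_exact k G (fun_of_row v).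
- have [bi|bi] := eqVneq #|b| i.
    have [a ->] := of_sizeP bi; rewrite -mul_taylor vd; exact: mxE.
  rewrite /tbd big1 // => c _.
  have [->|/taylor_neq0 ec] := eqVneq (taylor k c b) 0; first by rewrite mulr0.
  by rewrite fun_of_row_out ?mul0r // ec.
- by rewrite fun_of_row_out ?cards0.
exists (row_of_fun i.+2 w); apply/rowP => b.
rewrite mul_taylor tbd_row -?e ?fun_of_rowE //.
by have := enum_valP b; rewrite inE => /eqP.
Qed.

Lemma taylor_set1 (e : E) x y : adj x y -> val e = [set x; y] ->
  taylor k [set e] set0 =
  sgn k [set e] e *: ('X_(enum_rank x) * 'X_(enum_rank y)).
Proof.
move=> xy exy; rewrite /taylor -(setDv [set e]) delE ?set11 //; congr (_ *: _).
rewrite -mpolyXD; congr 'X_[_]; apply/mnmP => i; rewrite !mnmE setDv.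
have -> : cover_set set0 = set0 :> {set G} by apply: big_set0.
rewrite inE subn0 /cover_set big_set1 exy !inE.
have rk z : (enum_val i == z) = (enum_rank z == i).
  by apply/eqP/eqP => [<-|<-]; rewrite ?enum_valK ?enum_rankK.
rewrite !rk; case: eqP => [<-|_]; last by case: eqP.
by case: eqP => // /enum_rank_inj e'; rewrite e' adj_irr in xy.
Qed.

(** Only singletons contribute to the boundary at the empty set, each through its edge monomial up
    to sign. *)
Lemma edge_idealP (p : R) :
  edge_ideal p <-> exists w : {set E} -> R, p = tbd w set0.
Proof.
have tbdD w w' : tbd (fun c => w c + w' c) set0 = tbd w set0 + tbd w' set0 :> R.
  by rewrite -big_split; apply: eq_bigr => c _; rewrite mulrDl.
have tbd0 : tbd (fun=> 0) set0 = 0 :> R by rewrite /tbd big1 // => c _; rewrite mul0r.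
split=> [[f ->]|[w ->]].
  apply: (big_ind (fun p : R => exists w : {set E} -> R, p = tbd w set0)).
  - by exists (fun=> 0).
  - by move=> _ _ [w ->] [w' ->]; exists (fun c => w c + w' c).
  move=> x _.
  apply: (big_ind (fun p : R => exists w : {set E} -> R, p = tbd w set0)).
  - by exists (fun=> 0).
  - by move=> _ _ [w ->] [w' ->]; exists (fun c => w c + w' c).
  move=> y xy.
  pose e : E := Sub [set x; y] (edge_set xy).
  exists (fun c => if c == [set e] then (sgn k [set e] e)^-1 *: f x y else 0).
  rewrite /tbd (bigD1 [set e]) //= eqxx big1 ?addr0 => [|c /negPf->]; last exact: mul0r.
  rewrite (taylor_set1 xy) // -scalerAr -scalerAl scalerA mulfV ?scale1r //.
  by rewrite /sgn signr_eq0.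
apply: (big_ind (@edge_ideal k G)) => [|_ _ [f ->] [f' ->]|c _].
- by exists (fun _ _ => 0); rewrite big1 // => x _; rewrite big1 // => y _; rewrite mul0r.
- exists (fun x y => f x y + f' x y); rewrite -big_split; apply: eq_bigr => x _ /=.
  by rewrite -big_split; apply: eq_bigr => y _; rewrite mulrDl.
have [c1|] := eqVneq #|c| 1%N; last first.
  move=> c1; exists (fun _ _ => 0); rewrite [RHS]big1; last first.
    by move=> x _; rewrite big1 // => y _; rewrite mul0r.
  have [->|/taylor_neq0] := eqVneq (taylor k c set0) 0; first by rewrite mulr0.
  by rewrite cards0 => /eqP; rewrite (negPf c1).
have [e ->] : exists e, c = [set e] by apply/cards1P; rewrite c1.
have := valP e; rewrite inE => /existsP[x /existsP[y /andP[xy /eqP exy]]].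
(* [edge_ideal] sums over ordered pairs, so the coefficient is placed on one orientation of the
   edge. *)
exists (fun x' y' => if (x' == x) && (y' == y) then sgn k [set e] e *: w [set e] else 0).
rewrite (taylor_set1 xy exy) (bigD1 x) //= [X in _ = _ + X]big1 ?addr0; last first.
  by move=> x' /negPf ->; rewrite big1 // => y' _; rewrite mul0r.
rewrite (bigD1 y) //= !eqxx [X in _ = _ + X]big1 ?addr0; last first.
  by move=> y' /andP[_ /negPf ->]; rewrite mul0r.
by rewrite -scalerAr -scalerAl.
Qed.

Lemma taylor_resolution : graded_free_resolution taylor_seq (@edge_ideal k G).
Proof.
have aug (v : 'rV[R]_#|of_size E 0|) : (v *m gaug taylor_seq) 0 0 = fun_of_row v set0.
  rewrite mxE /fun_of_row; apply: eq_big => a; last by rewrite mxE mulr1.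
  by have := enum_valP a; rewrite inE cards_eq0 => ->.
have I0 : edge_ideal (0 : R).
  by apply/edge_idealP; exists (fun=> 0); rewrite /tbd big1 // => c _; rewrite mul0r.
split; [split | | |exact: taylor_exact].
- move=> a m; rewrite mxE msupp1 inE => /eqP->; rewrite mdeg0 /=.
  have := enum_valP a; rewrite inE cards_eq0 => /eqP->.
  by rewrite /cover_set big_set0 cards0.
- move=> i a b m; rewrite mxE /taylor.
  have [->|/del_sub sub] := eqVneq (del (@sgn k E) (enum_val a) (enum_val b)) 0.
    by rewrite scale0r msupp0.
  move=> /msuppZ_le; rewrite msuppX inE => /eqP->.
  by rewrite /= -!mdeg_cover_mon -mdegD submK // cover_mon_mono.
- move=> p; exists (row_of_fun 0 (fun=> p)).
  by rewrite aug fun_of_row_of_fun cards0 eqxx subrr.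
move=> v; rewrite aug; split=> [/edge_idealP[w e]|[w ->]].
  exists (row_of_fun 1 w); apply/rowP => b; rewrite mul_taylor -fun_of_rowE.
  have := enum_valP b; rewrite inE cards_eq0 => /eqP->.
  by rewrite e tbd_row ?cards0.
apply/edge_idealP; exists (fun_of_row w).
have [a ea] := @of_sizeP E 0 set0 (cards0 _).
by rewrite {1}ea fun_of_rowE mul_taylor -ea.
Qed.

End TaylorResolution.

(** * Betti numbers *)

Section FiberHomology.
Variables (k : fieldType) (G : sgraph).
Notation E := {A : {set G} | A \in edges G}.
Notation F := (taylor_seq k G).
Notation d := (del (@sgn k E)).
Implicit Types (c b : {set E}).

Definition cover_card j : {set {set E}} := [set c | #|cover_set c| == j].

(** Modulo the variables an entry survives only if its monomial is 1, that is, if the degree does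
    not drop. *)
Lemma taylor_mcoeff0 j c b : c \in cover_card j ->
  (taylor k c b)@_0%MM = if b \in cover_card j then d c b else 0.
Proof.
rewrite !inE => /eqP cj; rewrite /taylor mcoeffZ mcoeffX.
have [->|/del_sub bc] := eqVneq (d c b) 0; first by rewrite mul0r if_same.
have cov : cover_set b \subset cover_set c by apply: cover_set_mono.
have -> : (cover_mon c - cover_mon b == 0)%MM = (#|cover_set b| == j).
  rewrite -mdeg_eq0 -!mdeg_cover_mon in cj *.
  have := submK (cover_mon_mono bc); move/(congr1 mdeg); rewrite mdegD cj => <-.
  by rewrite -[X in X == _ + _]add0n eqn_add2r eq_sym.
by case: (_ == j); rewrite ?mulr1 ?mulr0.
Qed.

Lemma mul_fiber i j (v : 'rV[k]_#|of_size E i.+1|) (b : 'I_#|of_size E i|) :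
  (forall c, fun_of_row v c != 0 -> c \in cover_card j) ->
  (v *m fiber_diff F i) 0 b =
  if enum_val b \in cover_card j then bd d (cover_card j) (fun_of_row v) (enum_val b)
  else 0.
Proof.
move=> hv.
have -> : fiber_diff F i = \matrix_(a, b) (taylor k (enum_val a) (enum_val b))@_0%MM.
  by apply/matrixP => a b'; rewrite !mxE.
rewrite (mulmx_size v (fun c b' => (taylor k c b')@_0%MM)).
rewrite (bigID (mem (cover_card j))) /= [X in _ + X]big1 ?addr0; last first.
  by move=> c; apply: contraNeq; rewrite mulf_eq0 negb_or => /andP[/hv].
case: ifP => [bj|bj]; first by apply: eq_bigr => c cj; rewrite (taylor_mcoeff0 _ cj) bj.
by rewrite big1 // => c cj; rewrite (taylor_mcoeff0 _ cj) bj mulr0.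
Qed.

Lemma fiber_compP i j (v : 'rV[k]_#|of_size E i|) :
  reflect (forall c, fun_of_row v c != 0 -> c \in cover_card j)
    (v <= fiber_comp F i j)%MS.
Proof.
have mulE (u : 'rV[k]_#|of_size E i|) a :
    (u *m fiber_comp F i j) 0 a = u 0 a * (enum_val a \in cover_card j)%:R.
  by rewrite /fiber_comp mul_mx_diag !mxE inE.
apply: (iffP idP) => [/submxP[u ->] c|h].
  have [ci|ci] := eqVneq #|c| i; last by rewrite fun_of_row_out ?eqxx.
  have [a ->] := of_sizeP ci; rewrite fun_of_rowE mulE.
  by case: (_ \in _); rewrite ?mulr0 ?eqxx.
apply/submxP; exists v; apply/rowP => a; rewrite mulE.
have [->|va] := eqVneq (v 0 a) 0; first by rewrite mul0r.
by rewrite h ?mulr1 // fun_of_rowE.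
Qed.

Lemma fiber_cyclesP i j (v : 'rV[k]_#|of_size E i|) :
  reflect ((forall c, fun_of_row v c != 0 -> c \in cover_card j) /\
           cycle_on d (cover_card j) (fun_of_row v))
    (v <= fiber_cycles F i j)%MS.
Proof.
case: i v => [|i] v /=.
  apply: (iffP (fiber_compP j v)) => [h|[]//]; split=> // b bj; rewrite /bd big1 // => c _.
  have [->|/del_graded] := eqVneq (d c b) 0; first by rewrite mulr0.
  by rewrite /card_deg => cb; rewrite fun_of_row_out ?mul0r // cb.
rewrite sub_capmx; apply: (iffP andP) => -[].
  move=> /fiber_compP hv /sub_kermxP vd; split=> // b bj.
  have [bi|bi] := eqVneq #|b| i.
    have [a ea] := of_sizeP bi; have := mul_fiber a hv.
    by rewrite vd -ea bj mxE.
  rewrite /bd big1 // => c _.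
  have [->|/del_graded] := eqVneq (d c b) 0; first by rewrite mulr0.
  by rewrite /card_deg => cb; rewrite fun_of_row_out ?mul0r // cb.
move=> hv cv; split; first exact/fiber_compP.
by apply/sub_kermxP/rowP => b; rewrite (mul_fiber b hv) mxE; case: ifP => // /cv.
Qed.

Lemma fiber_boundariesP i j (v : 'rV[k]_#|of_size E i|) :
  (v <= fiber_boundaries F i j)%MS <->
  (exists2 u : 'rV[k]_#|of_size E i.+1|,
      forall c, fun_of_row u c != 0 -> c \in cover_card j & v = u *m fiber_diff F i).
Proof.
rewrite /fiber_boundaries; split.
  move=> /submxP[u ->]; exists (u *m fiber_comp F i.+1 j); last by rewrite mulmxA.
  by apply/fiber_compP; apply: submxMl.
by move=> [u /fiber_compP/submxP[u' ->] ->]; rewrite -mulmxA submxMl.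
Qed.

Lemma cover_card_complex j : is_complex d (cover_card j).
Proof.
apply: del_complex; first exact: sgn_system.
move=> a b c; rewrite !inE => /eqP aj /eqP cj cb ba; apply/eqP/anti_leq.
by rewrite -{1}aj -{1}cj !subset_leq_card //; apply: cover_set_mono.
Qed.

(** Boundaries are contained in cycles, so the difference of ranks is non-zero exactly when some
    cycle is not a boundary; the rest translates between rows and functions. *)
Lemma fiber_homology_NZ i j :
  fiber_homology_dim F i j != 0%N <-> NZ k (cover_card j) i.
Proof.
have leBC : (fiber_boundaries F i j <= fiber_cycles F i j)%MS.
  apply/rV_subP => v /fiber_boundariesP[u hu ->]; apply/fiber_cyclesP.
  have e : {in cover_card j, fun_of_row (u *m fiber_diff F i) =1
      bd d (cover_card j) (fun_of_row u)}.
    move=> c cj; have [ci|ci] := eqVneq #|c| i.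
      by have [a ea] := of_sizeP ci; rewrite ea fun_of_rowE (mul_fiber a hu) -ea cj.
    rewrite fun_of_row_out // /bd big1 // => c' _.
    have [->|/del_graded] := eqVneq (d c' c) 0; first by rewrite mulr0.
    by rewrite /card_deg => cb; rewrite fun_of_row_out ?mul0r // cb.
  split=> [c|b bj]; last by rewrite (eq_bd _ e) bd_bd //; apply: cover_card_complex.
  have [ci|ci] := eqVneq #|c| i; last by rewrite fun_of_row_out ?eqxx.
  have [a ->] := of_sizeP ci; rewrite fun_of_rowE (mul_fiber a hu).
  by case: ifP; rewrite ?eqxx.
rewrite /fiber_homology_dim subn_eq0 -ltnNge.
have [_ rk] := mxrank_leqif_sup leBC.
have -> : (\rank (fiber_boundaries F i j) < \rank (fiber_cycles F i j))%N =
          ~~ (fiber_cycles F i j <= fiber_boundaries F i j)%MS.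
  by rewrite ltn_neqAle mxrankS // andbT rk.
rewrite /NZ (nonzero_homologyP _ _ (@del_graded _ _ _)); split.
  move=> nCB.
  have [r nr] : exists r, ~~ (row r (fiber_cycles F i j) <= fiber_boundaries F i j)%MS.
    by apply/existsP; rewrite -negb_forall; apply: contra nCB => /forallP h; apply/row_subP.
  have /fiber_cyclesP[hv cv] := row_sub r (fiber_cycles F i j).
  set v : 'rV[k]_#|of_size E i| := row r _ in nr hv cv.
  exists (fun_of_row v); split=> //.
    by move=> c _; apply: contraNeq => /(fun_of_row_out v)/eqP.
  move=> [w0 e0]; case/negP: nr; apply/fiber_boundariesP.
  pose w1 c := if card_deg c == i.+1 then w0 c else 0.
  have e1 : {in cover_card j, forall b, fun_of_row v b = bd d (cover_card j) w1 b}.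
    apply: (bd_homog (@del_graded _ _ _) e0) => b _ vb; congr _.+1; apply/eqP.
    by apply: contraNT vb => /(fun_of_row_out v)->; rewrite eqxx.
  have hu c : fun_of_row (row_of_fun i.+1 (cut (cover_card j) w1)) c = cut (cover_card j) w1 c.
    by rewrite fun_of_row_of_fun /cut /w1 /card_deg; case: (c \in _); case: (#|c| == _).
  have hu' c : fun_of_row (row_of_fun i.+1 (cut (cover_card j) w1)) c != 0 -> c \in cover_card j.
    by rewrite hu /cut; case: ifP; rewrite ?eqxx.
  exists (row_of_fun i.+1 (cut (cover_card j) w1)) => //; apply/rowP => a.
  rewrite (mul_fiber a hu') -fun_of_rowE; case: ifP => aj; last first.
    by apply/eqP; apply: contraFT aj => /hv.
  rewrite e1 // -(bd_cut _ _ _ (subxx _)); apply: eq_bd => c _.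
  by rewrite hu.
move=> [v [hv cv nb]]; apply/negP => CB; apply: nb.
pose v' := row_of_fun i (cut (cover_card j) v).
have ev c : fun_of_row v' c = cut (cover_card j) v c.
  rewrite fun_of_row_of_fun /cut; case: ifP => // ci; case: ifP => // cj.
  by apply/esym/eqP; apply: contraFT ci => /(hv _ cj)/eqP.
have hv' c : fun_of_row v' c != 0 -> c \in cover_card j.
  by rewrite ev /cut; case: ifP; rewrite ?eqxx.
have e' : {in cover_card j, fun_of_row v' =1 v} by move=> c cj; rewrite ev /cut cj.
have : (v' <= fiber_cycles F i j)%MS.
  by apply/fiber_cyclesP; split=> // b bj; rewrite (eq_bd _ e') cv.
move=> /submx_trans/(_ CB)/fiber_boundariesP[u hu eu].
exists (fun_of_row u) => b bj; rewrite -e' // eu.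
have [bi|bi] := eqVneq #|b| i.
  by have [a ea] := of_sizeP bi; rewrite ea fun_of_rowE (mul_fiber a hu) -ea bj.
rewrite fun_of_row_out // /bd big1 // => c' _.
have [->|/del_graded] := eqVneq (d c' b) 0; first by rewrite mulr0.
by rewrite /card_deg => cb; rewrite fun_of_row_out ?mul0r // cb.
Qed.

(** A deletion can only shrink the union of the edges. In fixed total degree [j] it therefore
    preserves the union, and the complex splits by multidegree. *)
Lemma NZ_cover_card i j :
  NZ k (cover_card j) i <-> exists2 W : {set G}, #|W| = j & NZ k (covers W) i.
Proof.
have fd : {in cover_card j &, forall c b, d c b != 0 -> cover_set c = cover_set b}.
  move=> c b; rewrite !inE => /eqP cj /eqP bj /del_sub/cover_set_mono cb.
  by apply/esym/eqP; rewrite eqEcard cb cj bj leqnn.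
rewrite /NZ (nonzero_homology_partition _ _ fd).
have sl (W : {set G}) : #|W| = j -> [set c in cover_card j | cover_set c == W] = covers W.
  move=> Wj; apply/setP => c; rewrite !inE.
  by case: (cover_set c =P W) => [->|]; rewrite ?andbF // Wj eqxx.
split=> [[W h]|[W Wj h]]; last by exists W; rewrite sl.
suff Wj : #|W| = j by exists W; rewrite -?sl.
by have [c] := nonzero_homology_cell h; rewrite !inE => /andP[/eqP <- /eqP ->].
Qed.

End FiberHomology.

(** * Deleting a vertex *)

Section VertexSplit.
Variables (k : fieldType) (B : sgraph).
Implicit Types (a U : {set B}).

Lemma NZ_Ind0 : NZ k (Ind (set0 : {set B})) 0.
Proof.
have Ind0 : Ind (set0 : {set B}) = [set set0].
  apply/setP => a; rewrite !inE subset0; case: eqP => // ->.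
  by apply/independentP => x y; rewrite inE.
have d0 : del (@sgn k B) set0 set0 = 0 by rewrite /del big1 // => x; rewrite inE.
have cy (d : {set B} -> {set B} -> k) :
    d set0 set0 = 0 -> cycle_on d (Ind (set0 : {set B})) (fun=> 1).
  by move=> e a; rewrite /bd Ind0 big_set1 !inE => /eqP->; rewrite e mulr0.
exists (fun=> 1), (fun=> 1); split; try exact: cy.
- by move=> a; rewrite Ind0 inE => /eqP-> _; apply: cards0.
- by move=> a; rewrite Ind0 inE => /eqP-> _; apply: cards0.
by rewrite Ind0 big_set1 mulr1 oner_eq0.
Qed.

(** The independent sets avoiding [u] form a subcomplex. The quotient is spanned by those containing
    [u], which are [u] joined to the independent sets of its non-neighbours; this shifts the degree
    by one. *)
Lemma NZ_Ind_vertex U u i : u \in U -> NZ k (Ind U) i.+1 ->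
  NZ k (Ind (U :\ u)) i.+1 \/ NZ k (Ind [set v in U :\ u | ~~ adj u v]) i.
Proof.
move=> uU h; have cx := del_complex (@sgn_system k B setT) (@Ind_convex B U).
have QP : Ind (U :\ u) \subset Ind U.
  by apply/subsetP => a; rewrite !inE => /andP[aU ->]; rewrite (subset_trans aU) ?subsetDl.
have QE a : a \in Ind U -> (a \in Ind (U :\ u)) = (u \notin a).
  by rewrite !inE => /andP[aU ->]; rewrite andbT subsetD1 aU.
have Qsub : {in Ind (U :\ u) & Ind U :\: Ind (U :\ u), forall a b, del (@sgn k B) a b = 0}.
  move=> a b Qa /setDP[Pb nQb]; apply/eqP; apply: contraNT nQb => /del_sub ba.
  rewrite QE // (contra (subsetP ba u)) // -QE //; exact: subsetP Qa.
have [|h'] := nonzero_homology_split QP cx Qsub (@del_graded _ _ _) h; first by left.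
right; rewrite -(addn1 i) -(cards1 u) in h'; move: h'.
set Y := [set v in U :\ u | ~~ adj u v].
have YU : Y \subset U by apply/subsetP => x; rewrite !inE => /andP[/andP[]].
have addu (a : {set B}) : a \subset Y -> u |: a \in Ind U = (a \in Ind Y).
  move=> aY; rewrite !inE subUset sub1set uU aY (subset_trans aY YU) /=.
  apply/idP/idP => [|/independentP ia]; first exact/independent_sub/subsetUr.
  have ua x : x \in a -> ~~ adj u x by move/(subsetP aY); rewrite inE => /andP[].
  apply/independentP => x y /setU1P[->|xa] /setU1P[->|ya]; rewrite ?adj_irr ?ua //.
    by rewrite adj_sym ua.
  exact: ia.
have in_quot a : (a \in Ind U :\: Ind (U :\ u)) = (a \in Ind U) && (u \in a).
  by rewrite inE andbC; have [/QE->|//] := boolP (a \in Ind U); rewrite negbK.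
apply: (proj2 (@NZ_image k _ _ id Y [set u] _ _ i _ _ _ _ _)) => //.
- by move=> x; rewrite !inE => /andP[/andP[]].
- exact: Ind_powerset.
- move=> a; rewrite powersetE => aY; rewrite imset_id setUC in_quot addu //.
  by rewrite setU11 andbT.
move=> a; rewrite in_quot => /andP[]; rewrite inE => /andP[aU /independentP ia] ua.
exists (a :\ u); last by rewrite imset_id setUC setD1K.
apply/subsetP => x; rewrite !inE => /andP[xu xa].
by rewrite xu (subsetP aU) // ia.
Qed.

End VertexSplit.

Lemma NZ_embedding (k : fieldType) (B B' : sgraph) (f : B' -> B) (U : {set B'}) i :
  injective f -> {mono f : x y / adj x y} ->
  NZ k (Ind U) i <-> NZ k (Ind (f @: U)) i.
Proof.
move=> f_inj f_adj; rewrite -[in X in _ <-> X](addn0 i) -(@cards0 B).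
apply: (@NZ_image k _ _ f U) => [//|x _|||b].
- by rewrite inE.
- exact: Ind_powerset.
- move=> a; rewrite powersetE => aU; rewrite setU0 !inE imsetS // aU /=.
  apply/independentP/independentP => [ia x y xa ya|ia _ _ /imsetP[x xa ->] /imsetP[y ya ->]].
    by rewrite -f_adj ia ?imset_f.
  by rewrite f_adj ia.
rewrite inE => /andP[/subsetP bU _]; exists (U :&: f @^-1: b); first exact: subsetIl.
rewrite setU0; apply/setP => y; apply/idP/imsetP => [yb|[x]]; last first.
  by rewrite !inE => /andP[_ xb] ->.
by have /imsetP[x xU ey] := bU y yb; exists x; rewrite // !inE xU -ey.
Qed.

(** * Embedding the subdivision of an induced subgraph in that of the graph *)

Section SubdivisionOfInduced.
Variables (G : sgraph) (W : {set G}).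
Notation H := (induced W).

Lemma val_edge (e : {A : {set H} | A \in edges H}) : [set val x | x in val e] \in edges G.
Proof.
have := valP e; rewrite inE => /existsP[x /existsP[y /andP[xy /eqP ->]]].
by rewrite imsetU1 imset_set1; apply: edge_set.
Qed.

Definition subdivision_val (u : subdivision H) : subdivision G :=
  match u with
  | inl x => inl (val x)
  | inr e => inr (exist (fun A => A \in edges G) _ (val_edge e))
  end.

Lemma subdivision_val_inj : injective subdivision_val.
Proof.
move=> [x|e] [y|f] //= []; first by move/val_inj->.
by move/(imset_inj val_inj)/val_inj->.
Qed.

Lemma subdivision_val_adj : {mono subdivision_val : u v / adj u v}.
Proof. by move=> [x|e] [y|f] //=; rewrite mem_imset //; apply: val_inj. Qed.

Lemma subdivision_val_image (U : {set subdivision G}) : U \subset incident W ->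
  exists U' : {set subdivision H}, U = subdivision_val @: U'.
Proof.
move=> UW; exists (subdivision_val @^-1: U); apply/setP => u.
apply/idP/imsetP => [uU|[v]]; last by rewrite inE => vU ->.
have := subsetP UW u uU; rewrite inE; case: u uU => [x|e] uU.
  by move=> xW; exists (inl (Sub x xW)); rewrite ?inE.
have := valP e; rewrite inE => /existsP[x /existsP[y /andP[xy /eqP exy]]].
rewrite exy subUset !sub1set => /andP[xW yW].
have xyH : [set (Sub x xW : H); (Sub y yW : H)] \in edges H by apply: edge_set.
pose e' : {A : {set H} | A \in edges H} := exist (fun A => A \in edges H) _ xyH.
have ee : e = exist (fun A => A \in edges G) _ (val_edge e').
  by apply: val_inj; rewrite /= imsetU1 imset_set1.
by exists (inr e'); rewrite ?inE /= -ee.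
Qed.

Lemma subdivision_val_sub (U' : {set subdivision H}) : subdivision_val @: U' \subset incident W.
Proof.
apply/subsetP => _ /imsetP[[x|e] _ ->]; rewrite inE /=; first exact: valP.
by apply/subsetP => _ /imsetP[x _ ->]; apply: valP.
Qed.

End SubdivisionOfInduced.

(** * Reading off the invariants, and the minimality argument *)

Section Invariants.
Variables (k : fieldType) (G : sgraph).

Lemma is_proj_dimI p : (exists W : {set G}, NZ k (covers W) p) ->
  (forall (W : {set G}) i, NZ k (covers W) i -> (i <= p)%N) -> is_proj_dim k G p.
Proof.
move=> [W hW] ub; exists (fiber_homology_dim (taylor_seq k G)).
  by exists (taylor_seq k G); [exact: taylor_resolution|].
split; first by exists #|W|; apply/eqP/fiber_homology_NZ/NZ_cover_card; exists W.
by move=> i j /eqP/fiber_homology_NZ/NZ_cover_card[W' _]; apply: ub.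
Qed.

(** By duality, homology of [Ind U] in cardinality [s] amounts to a non-zero Betti number with
    [i = #|U| - s] and [j = #|U|], so [s] is [j - i]. *)
Lemma is_regI r : (exists U : {set G}, NZ k (Ind U) r) ->
  (forall (U : {set G}) s, NZ k (Ind U) s -> (s <= r)%N) -> is_reg k G r.
Proof.
move=> [U hU] ub; exists (fiber_homology_dim (taylor_seq k G)).
  by exists (taylor_seq k G); [exact: taylor_resolution|].
have rU : (r <= #|U|)%N := NZ_le (Ind_powerset U) hU.
split.
  exists (#|U| - r)%N; rewrite subnK //; apply/eqP/fiber_homology_NZ/NZ_cover_card.
  by exists U; last exact: NZ_Ind_covers.
move=> i j /eqP/fiber_homology_NZ/NZ_cover_card[U' <- /NZ_covers_Ind[iU' /ub]].
by rewrite leq_subLR.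
Qed.

End Invariants.

Lemma exists_max (Q : nat -> Prop) n : Q 0%N -> (forall i, Q i -> (i <= n)%N) ->
  exists p, Q p /\ forall i, Q i -> (i <= p)%N.
Proof.
move=> Q0; elim: n => [|n IHn] ub; first by exists 0%N.
have [Qn|nQn] := classic (Q n.+1); first by exists n.+1.
apply: IHn => i Qi; have := ub i Qi; rewrite leq_eqVlt => /predU1P[ei|//].
by rewrite ei in Qi.
Qed.

Lemma exists_min (T : Type) (f : T -> nat) (Q : T -> Prop) x0 : Q x0 ->
  exists2 x, Q x & forall y, Q y -> (f x <= f y)%N.
Proof.
have [n] := ubnP (f x0); elim: n x0 => // n IHn x0 fx0 Qx0.
have [[y [Qy yx]]|nQ] := classic (exists y, Q y /\ (f y < f x0)%N).
  exact: (IHn y (leq_trans yx fx0)).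
by exists x0 => // y Qy; rewrite leqNgt; apply/negP => yx; apply: nQ; exists y.
Qed.

(** For minimal [U'] the deletion of a vertex [x] kills the homology, so the link of [x] carries it
    one degree lower; the link avoids [x] and all edges through [x]. *)
Lemma incident_descent (k : fieldType) (G : sgraph) (W : {set G})
    (U : {set subdivision G}) s :
  U \subset incident W -> NZ k (Ind U) s.+1 ->
  exists (x : G) (U' : {set subdivision G}),
    [/\ x \in W, U' \subset incident (W :\ x) & NZ k (Ind U') s].
Proof.
move=> UW hU; pose Q (U' : {set subdivision G}) := U' \subset incident W /\ NZ k (Ind U') s.+1.
have {UW hU}[U' [UW hU] minU] := exists_min (fun U' : {set _} => #|U'|) (conj UW hU : Q U).
(* Otherwise [U'] consists of edges and is independent. Contracting all of it leaves at most the
   empty set, whose degree is 0 and not [s.+1]. *)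
have [x xU] : exists x, inl x \in U'.
  apply/existsP; apply: contraT => /existsPn noV.
  have iU : independent (U' :\: set0).
    apply/independentP => -[x|e] [y|f] //; rewrite setD0 => uU vU.
    - by rewrite (negPf (noV x)) in uU.
    - by rewrite (negPf (noV y)) in vU.
  have /nonzero_homology_cell[a] := proj1 (NZ_dominating _ _ iU) hU.
  by rewrite !inE subset0 => /and3P[_ /eqP-> _]; rewrite /card_deg cards0.
have [h|h] := NZ_Ind_vertex xU hU.
  have := minU (U' :\ inl x) (conj (subset_trans (subsetDl _ _) UW) h).
  by rewrite (cardsD1 (inl x) U') xU ltnn.
exists x, [set v in U' :\ inl x | ~~ adj (inl x : subdivision G) v]; split=> //.
  by have := subsetP UW _ xU; rewrite inE.
apply/subsetP => v; rewrite !inE => /andP[/andP[vx vU] nadj].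
have := subsetP UW v vU; rewrite inE; case: v vx vU nadj => [y|e] vx vU nadj /=.
  by move=> yW; rewrite !inE yW andbT; apply: contra vx => /eqP->.
by move=> eW; rewrite subsetD1 eW.
Qed.

Theorem corollary4p4 (k : fieldType) (G : sgraph) :
  exists (W : {set G}) (p : nat),
    is_proj_dim k G p /\ is_reg k (subdivision (induced W)) p.
Proof.
have [p [[V hV] ub]] : exists p, (exists W : {set G}, NZ k (covers W) p) /\
    forall i, (exists W : {set G}, NZ k (covers W) i) -> (i <= p)%N.
  (* The empty cover of the empty set gives degree 0, and no degree exceeds the number of
     vertices. *)
  apply: (@exists_max _ #|G|) => [|i [W /NZ_covers_Ind[iW _]]].
    exists set0; have := NZ_Ind_covers (NZ_Ind0 k G); by rewrite cards0.
  exact: leq_trans iW (max_card _).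
(* Asking for [p <= s] instead of equality lets the descent from any degree above [p] contradict
   minimality. *)
pose Q (W : {set G}) := exists (U : {set subdivision G}) s,
  [/\ U \subset incident W, (p <= s)%N & NZ k (Ind U) s].
have QV : Q V by exists (incident V), p; split=> //; apply/NZ_covers.
have [W [U [s [UW ps hU]]] minW] := exists_min (fun W : {set G} => #|W|) QV.
have regW (U' : {set subdivision G}) s' :
    U' \subset incident W -> NZ k (Ind U') s' -> (s' <= p)%N.
  move=> UW' hU'; rewrite leqNgt; apply/negP; case: s' hU' => // s' hU' ps'.
  have [x [U2 [xW UW2 hU2]]] := incident_descent UW' hU'.
  (* From [p < s'.+1] follows [p <= s'], so [W :\ x] still satisfies [Q]. *)
  have : (#|W| <= #|W :\ x|)%N by apply: minW; exists U2, s'.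
  by rewrite (cardsD1 x W) xW ltnn.
exists W, p; split.
  by apply: is_proj_dimI => [|W' i hi]; [exists V | apply: ub; exists W'].
have emb (U' : {set subdivision (induced W)}) i :=
  NZ_embedding k U' i (@subdivision_val_inj G W) (@subdivision_val_adj G W).
apply: is_regI => [|U' i /emb]; last exact/regW/subdivision_val_sub.
have [U' eU] := subdivision_val_image UW; exists U'; apply/emb; rewrite -eU.
(* The bound just proved for [W] also applies to its own witness, so the degree [s] is exactly
   [p]. *)
by have <- : s = p by apply/anti_leq; rewrite ps (regW U s).
Qed.
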